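(* Let $V$ be a real inner-product space of finite dimension $d\ge1$ with the norm induced by the inner product, let $U$ be an abelian group with a translation-invariant ultrametric, let $\Lambda\subset V\times U$ be a closed additive subgroup, and let $X=(V\times U)/\Lambda$ carry the quotient metric induced by the maximum product metric. Let $m_\Lambda$ be the effective real dimension of the quotient. Then for every $\alpha\in X$ and every integer $N\ge2$: if $m_\Lambda\ge1$, then $$g_N(\alpha)\le\sigma^{>}_{m_\Lambda}+1;$$ if $m_\Lambda=0$, then $g_N(\alpha)\le2$. In particular, if $m_\Lambda=1,2,3$ then $g_N(\alpha)\le 3,6,13$ respectively, independently of the ambient dimension $d$.
   Context: Metric setting. Write the ultrametric on $U$ as $d_U(u,w)=|u-w|_U$, so $|u+w|_U\le\max\{|u|_U,|w|_U\}$. On $V\times U$ put $|(v,u)|=\max\{\|v\|_V,|u|_U\}$; ''closed'' refers to the induced metric topology. On $X=(V\times U)/\Lambda$ put $\|a+\Lambda\|_X=\inf_{\lambda\in\Lambda}|a-\lambda|$ and $d_X(x,y)=\|x-y\|_X$. Nearest-neighbour distances. For $\alpha\in X$ and $N\ge2$ let $\mathcal O_N(\alpha)=\{0,\alpha,\dots,(N-1)\alpha\}$ as a set (repetitions discarded). If it has at least two points put $\delta_N(x)=\min_{y\in\mathcal O_N(\alpha),\,y\ne x}d_X(x,y)$ and $g_N(\alpha)=\#\{\delta_N(x):x\in\mathcal O_N(\alpha)\}$; if it is a singleton, $g_N(\alpha)=0$. Effective real dimension. $W=\{v\in V:(tv,0)\in\Lambda\text{ for every }t\in\mathbb R\}$;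 $\pi:V\to W^\perp$ is orthogonal projection; $E_\Lambda=\operatorname{span}_{\mathbb R}\{\pi(v):(v,u)\in\Lambda\}$; $m_\Lambda=\dim E_\Lambda$. Strong kissing number. For $m\ge1$, $\sigma_m^{>}$ is the maximal cardinality of a set $C$ in the unit sphere $S^{m-1}\subset\mathbb R^m$ such that $\langle\xi,\eta\rangle<\tfrac12$ for all distinct $\xi,\eta\in C$. *)

(* Defs.v *)
From HB Require Import structures.
From mathcomp Require Import all_boot all_order all_algebra.
From mathcomp Require Import finmap.
From mathcomp Require Import all_classical all_reals topology.
From mathcomp Require Import ring lra.

Set Implicit Arguments.
Unset Strict Implicit.
Unset Printing Implicit Defensive.

Import Order.TTheory GRing.Theory Num.Theory.

Local Open Scope classical_set_scope.
Local Open Scope ring_scope.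
Local Open Scope quotient_scope.

(* With [idfun] as conjugation, {dot V for idfun} is the type of symmetric
   bilinear positive definite forms on V. *)
HB.mixin Record Vector_isInner (R : realType) V of Vector R V := {
  inner : {dot V for (@idfun R)}
}.

#[short(type="innerVectType")]
HB.structure Definition InnerVector (R : realType) :=
  {V of Vector R V & Vector_isInner R V}.

HB.mixin Record Metric_isInvariantUltrametric (R : realType) U
    of Metric R U & GRing.Zmodule U := {
  mdist_ultra : forall x y z : U,
    mdist x z <= Num.max (mdist x y) (mdist y z) ;
  mdistDr : forall z x y : U, mdist (x + z) (y + z) = mdist x y
}.

#[short(type="ultrametricZmodType")]
HB.structure Definition UltrametricZmodule (R : realType) :=
  {U of Metric R U & GRing.Zmodule U & Metric_isInvariantUltrametric R U}.

Section InnerNorm.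
Variables (R : realType) (V : innerVectType R).
Implicit Types u v : V.

Definition inorm v : R := Num.sqrt (inner v v).

Lemma innerC u v : inner u v = inner v u.
Proof. by rewrite hermC mul1r. Qed.

Lemma inner_gt0 v : v != 0 -> 0 < inner v v.
Proof. exact: neq0_dnorm_gt0. Qed.

Lemma inner_ge0 v : 0 <= inner v v.
Proof. by have [->|/inner_gt0/ltW//] := eqVneq v 0; rewrite linear0l. Qed.

Lemma inorm_ge0 v : 0 <= inorm v.
Proof. exact: sqrtr_ge0. Qed.

Lemma inorm0 : inorm 0 = 0.
Proof. by rewrite /inorm linear0l sqrtr0. Qed.

Lemma inorm_eq0 v : inorm v = 0 -> v = 0.
Proof.
move/eqP; rewrite sqrtr_eq0; apply: contraTeq => /inner_gt0.
by rewrite ltNge.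
Qed.

Lemma inormN v : inorm (- v) = inorm v.
Proof. by rewrite /inorm linearNl linearNr opprK. Qed.

Lemma innerDD u v :
  inner (u + v) (u + v) = inner u u + inner u v *+ 2 + inner v v.
Proof. by rewrite linearDl !linearD /= (innerC v u) mulr2n !addrA. Qed.

Lemma inner_CauchySchwarz u v : inner u v <= inorm u * inorm v.
Proof.
have [->|v0] := eqVneq v 0; first by rewrite linear0r inorm0 mulr0.
have a0 := inner_gt0 v0.
rewrite /inorm -sqrtrM ?inner_ge0// (le_trans (ler_norm _))// -sqrtr_sqr.
rewrite ler_wsqrtr//.
set a := inner v v in a0 *; set b := inner u v; set c := inner u u.
have := inner_ge0 (a *: u + (- b) *: v).
rewrite innerDD !(linearZl_LR, linearZr_LR) /= -/a -/b -/c => h.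
have {}h : 0 <= a * (a * c - b ^+ 2) by apply: le_trans h _; lra.
by move: h; rewrite pmulr_rge0// subr_ge0 mulrC.
Qed.

Lemma inormD u v : inorm (u + v) <= inorm u + inorm v.
Proof.
rewrite -(@ler_pXn2r _ 2)// ?nnegrE ?addr_ge0 ?inorm_ge0//.
rewrite sqrrD /inorm !sqr_sqrtr ?inner_ge0// innerDD.
by rewrite lerD2r lerD2l lerMn2r inner_CauchySchwarz.
Qed.

End InnerNorm.

(* An alias of V * U, so that it does not inherit the canonical pseudometric
   of a product of pseudometric spaces. *)
Definition maxprod (V U : Type) : Type := (V * U)%type.

HB.instance Definition _ (V U : zmodType) :=
  GRing.Zmodule.copy (maxprod V U) (V * U)%type.

Section MaxMetric.
Variables (R : realType) (V : innerVectType R) (U : ultrametricZmodType R).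
Implicit Types a b c : maxprod V U.

Definition maxnorm a : R := Num.max (inorm a.1) (mdist a.2 0).

Definition maxdist a b : R := maxnorm (a - b).

Let mdistB (x y : U) : mdist (x - y) 0 = mdist x y.
Proof. by rewrite -(mdistDr y) subrK add0r. Qed.

Lemma maxdistE a b :
  maxdist a b = Num.max (inorm (a.1 - b.1)) (mdist a.2 b.2).
Proof. by rewrite /maxdist /maxnorm mdistB. Qed.

Let maxdistxx a : maxdist a a = 0.
Proof. by rewrite maxdistE subrr inorm0 mdistxx maxxx. Qed.

Let maxdist_positivity a b : maxdist a b = 0 -> a = b.
Proof.
rewrite maxdistE => ab0.
have : inorm (a.1 - b.1) <= 0 by rewrite -ab0 le_max lexx.
have : mdist a.2 b.2 <= 0 by rewrite -ab0 le_max lexx orbT.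
case: a b {ab0} => [v u] [w z] /= uz vw; congr (_, _).
- by apply/subr0_eq/inorm_eq0/le_anti; rewrite vw inorm_ge0.
- by apply/mdist_positivity/le_anti; rewrite uz mdist_ge0.
Qed.

Let maxdist_sym a b : maxdist a b = maxdist b a.
Proof. by rewrite !maxdistE -inormN opprB metric_sym. Qed.

Let maxdist_triangle b a c : maxdist a c <= maxdist a b + maxdist b c.
Proof.
rewrite !maxdistE ge_max; apply/andP; split.
- rewrite -(subrKA b.1); apply: (le_trans (inormD _ _)).
  by apply: lerD; rewrite le_max lexx.
- apply: (le_trans (metric_triangle _ b.2 _)).
  by apply: lerD; rewrite le_max lexx orbT.
Qed.

HB.instance Definition _ := isMetric.Build R (maxprod V U)
  maxdistxx maxdist_positivity maxdist_sym maxdist_triangle.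

End MaxMetric.

Section Span.
Variables (R : realType) (V : vectType R).
Implicit Types (A : set V) (E F : {vspace V}).

Definition is_vspan A E :=
  {in A, forall v, v \in E} /\
  forall F, {in A, forall v, v \in F} -> (E <= F)%VS.

(* The linear span of an arbitrary subset; it exists by vspanP. *)
Definition vspan A : {vspace V} := xget 0%VS [set E | is_vspan A E].

Lemma ex_span_seq A :
  exists2 s : seq V, {in s, forall v, v \in A} & is_vspan A <<s>>%VS.
Proof.
pose P n := `[< exists s : seq V, {in s, forall v, v \in A} /\ \dim <<s>> = n >].
have P0 : exists n, P n.
  by exists 0; apply/asboolP; exists [::]; split=> //; rewrite span_nil dimv0.
have Pb n : P n -> (n <= \dim {:V})%N.
  by move=> /asboolP[s [_ <-]]; rewrite dimvS ?subvf.
case: (ex_maxnP P0 Pb) => n /asboolP[s [sA dims]] nmax.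
exists s => //; split=> [v vA|F AF]; last by apply/span_subvP => v /sA /AF.
have sv : (<<s>> <= <<v :: s>>)%VS by rewrite span_cons addvSr.
have : (\dim <<v :: s>> <= n)%N.
  apply: nmax; apply/asboolP; exists (v :: s); split=> // w.
  by rewrite in_cons => /orP[/eqP->|/sA].
rewrite -dims => vs; have -> : <<s>>%VS = <<v :: s>>%VS.
  by apply/eqP; rewrite eqEdim sv.
by rewrite memv_span ?mem_head.
Qed.

Lemma vspanP A : is_vspan A (vspan A).
Proof.
have [s _ sP] := ex_span_seq A.
by rewrite /vspan; case: xgetP => [E _ //|/(_ _ sP)].
Qed.

Lemma vspan_seq A :
  exists2 s : seq V, {in s, forall v, v \in A} & vspan A = <<s>>%VS.
Proof.
have [s sA [As smin]] := ex_span_seq A; have [Av vmin] := vspanP A.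
by exists s => //; apply: subv_anti; rewrite vmin ?smin.
Qed.

End Span.

Section EffectiveDimension.
Variables (R : realType) (V : innerVectType R) (U : ultrametricZmodType R).
Variable L : zmodClosed (maxprod V U).

Definition lineality_set : set V :=
  [set v | forall t : R, ((t *: v, 0) : maxprod V U) \in L].

Definition lineality : {vspace V} := vspan lineality_set.

Lemma mem_lineality v : v \in lineality <-> lineality_set v.
Proof.
split; last by move=> vL; apply: (vspanP _).1; rewrite inE.
rewrite /lineality; have [s sL ->] := vspan_seq lineality_set.
move=> vs t; rewrite (@coord_span _ _ _ (in_tuple s) _ vs) scaler_sumr.
elim/big_ind: _ => [|x y xL yL|i _].
- exact: rpred0.
- have -> : ((x + y, 0) : maxprod V U) = (x, 0) + (y, 0).
    by congr (_, _); rewrite addr0.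
  exact: rpredD.
- rewrite scalerA.
  by have /set_mem := sL _ (mem_nth 0 (ltn_ord i)); exact.
Qed.

Definition lineality_perp : {vspace V} := orthov inner lineality.

(* The projection onto the orthogonal complement parallel to [lineality]. *)
Definition perp_proj : 'End(V) := daddv_pi lineality_perp lineality.

Definition effective_space : {vspace V} :=
  vspan [set perp_proj a.1 | a in [set a : maxprod V U | a \in L]].

Definition effective_dim : nat := \dim effective_space.

End EffectiveDimension.

Section Quotient.
Variables (R : realType) (V : innerVectType R) (U : ultrametricZmodType R).
Variable L : zmodClosed (maxprod V U).
Local Notation X := (Quotient.quot L).
Implicit Types x y alpha : X.

Definition quot_norm x : R :=
  inf [set maxnorm (repr x - l) | l in [set l : maxprod V U | l \in L]].

Lemma quot_norm_pi (a : maxprod V U) :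
  quot_norm (\pi_X a) =
  inf [set maxnorm (a - l) | l in [set l : maxprod V U | l \in L]].
Proof.
have raL : repr (\pi_X a) - a \in L by rewrite Quotient.idealrBE reprK.
congr inf; apply/seteqP; split=> _ [l /= lL <-].
- exists (l - (repr (\pi_X a) - a)); first exact: rpredB.
  by rewrite opprB addrA [a + _]addrC subrK.
- exists (l + (repr (\pi_X a) - a)); first exact: rpredD.
  by rewrite opprD addrA opprB [_ + (a - _)]addrC addrA subrK.
Qed.

Definition quot_dist x y : R := quot_norm (x - y).

Definition multiples (N : nat) alpha : {fset X} :=
  [fset alpha *+ i | i in iota 0 N]%fset.

(* The least element of a nonempty sequence (0 for the empty one). *)
Definition seq_min (s : seq R) : R := \big[Num.min/head 0 s]_(r <- s) r.

(* [nn_dist N alpha x] is only meaningful when [multiples N alpha] has a point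
   other than [x]. *)
Definition nn_dist N alpha x : R :=
  seq_min [seq quot_dist x y | y <- multiples N alpha & y != x].

Definition nn_count N alpha : nat :=
  if (1 < #|` multiples N alpha|)%N
  then #|` [fset nn_dist N alpha x | x in multiples N alpha]%fset|
  else 0.

End Quotient.

Section Kissing.
Variable R : realType.

Definition strict_spherical_code m (C : {fset 'rV[R]_m}) : Prop :=
  (forall xi, xi \in C -> (xi *m xi^T) 0 0 = 1) /\
  (forall xi eta, xi \in C -> eta \in C -> xi != eta ->
     (xi *m eta^T) 0 0 < 2^-1).

Definition is_strong_kissing m k : Prop :=
  (exists2 C : {fset 'rV[R]_m}, strict_spherical_code C & #|` C| = k) /\
  (forall C : {fset 'rV[R]_m}, strict_spherical_code C -> (#|` C| <= k)%N).

(* The maximum of the cardinalities; the value 0 would only be taken if they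
   were unbounded. *)
Definition strong_kissing m : nat := xget 0%N [set k | is_strong_kissing m k].

End Kissing.

(* Main.v *)
(** Put [h = N./2] and let [D] be the least value of [|k alpha|] for
    [0 < k <= h].  When the [N] points are distinct, every nearest-neighbour
    distance is either [D] or some [|q alpha| < D] with [h < q < N].  Lift these
    [q alpha] to vectors [v_q], [|v_q| < D]; differences of two of the [q]'s are
    less than [h], so that [|v_p - v_q| >= D].  Projecting off the direction of
    [alpha] orthogonal to the effective space only helps, and leaves vectors of
    the effective space at pairwise angles greater than 60 degrees: this is the
    bound by the strong kissing number.

    In dimension 3 the value of the kissing number is not needed.  The pairs
    [(v_q, q)] lie in a group [G] of pairs [(v, k)] such that [|v| >= D] whenever
    [0 < k <= h], and [G] has at most [2^4] classes modulo the closure [K] of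
    [2G].  Halving elements of [K] shows that [|v| >= 2D] for [(v, k)] in [K] with
    [0 < k <= 2h], so the [(v_q, q)] have distinct nonzero classes.  If there were
    13 of them, they would contain a Fano plane, hence [x], [y], [z] such
    that on each of the lines [xy], [xz], [yz] the third point has the smallest
    [q].  When [i] is the third point of the line [jk], [v_i + v_j - v_k] and
    [v_i - v_j + v_k] have norm at least [2D], whence
    [2 <v_j, v_k> < - D^2]; three vectors of norm less than [D] cannot satisfy
    this pairwise.  In dimension 2, Delsarte's method bounds the strong kissing
    number. *)

Require Import Defs.
From HB Require Import structures.
From mathcomp Require Import all_boot all_order all_algebra.
From mathcomp Require Import finmap.
From mathcomp Require Import all_classical all_reals topology.
From mathcomp Require Import zify ring lra.

Set Implicit Arguments.
Unset Strict Implicit.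
Unset Printing Implicit Defensive.

Import Order.TTheory GRing.Theory Num.Theory.

Local Open Scope classical_set_scope.
Local Open Scope ring_scope.

(** * Packing *)

(** Grid pigeonhole: rounding [(c i x + B) / e] down puts each point in one of [K ^ n] cells, and
    two points of one cell differ by less than [e] in every coordinate. *)
Lemma separated_size (R : realType) (T : eqType) n (c : 'I_n -> T -> R)
    (B e : R) K (s : seq T) :
  0 < e -> 2 * B / e < K%:R -> uniq s ->
  (forall x i, x \in s -> `|c i x| <= B) ->
  (forall x y, x \in s -> y \in s -> x != y -> exists i, e <= `|c i x - c i y|) ->
  (size s <= K ^ n)%N.
Proof.
move=> e0 BK us sB sep.
case: K BK => [|K] BK.
  case: s us sB sep => [//|x s] us sB sep.
  case: n c sB sep => [|n] c sB sep; last first.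
    have B0 : 0 <= B by apply: le_trans (normr_ge0 (c ord0 x)) (sB _ _ (mem_head _ _)).
    by move: BK; rewrite ltNge; move/negP; case; rewrite divr_ge0 ?mulr_ge0 // ltW.
  rewrite expn0; case: s us sB sep => [//|y s] /= /andP[+ _] _ /(_ x y).
  rewrite !inE !eqxx orbT negb_or => /andP[xy _] /(_ isT isT xy) [[]]; lia.
pose f x := [ffun i => inord (Num.truncn ((c i x + B) / e)) : 'I_K.+1].
have fE x i : x \in s -> f x i = Num.truncn ((c i x + B) / e) :> nat.
  move=> /(sB _ i); rewrite ler_norml => /andP[l u].
  rewrite ffunE inordK // truncn_lt_nat; last first.
    by rewrite divr_ge0 ?(ltW e0) //; lra.
  by apply: le_lt_trans BK; rewrite ler_pM2r ?invr_gt0 //; lra.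
have finj : {in s &, injective f}.
  move=> x y xs ys fxy; apply/eqP; apply: contraT => xy.
  have [i] := sep _ _ xs ys xy.
  have := congr1 (fun g : {ffun _} => nat_of_ord (g i)) fxy; rewrite !fE //.
  move: (sB _ i xs) (sB _ i ys); rewrite !ler_norml => /andP[lx _] /andP[ly _].
  have /truncn_itv : 0 <= (c i x + B) / e.
    by rewrite divr_ge0 ?(ltW e0) //; lra.
  have /truncn_itv : 0 <= (c i y + B) / e.
    by rewrite divr_ge0 ?(ltW e0) //; lra.
  move=> + + E; rewrite E; set k := Num.truncn _.
  rewrite -!natr1 !ler_pdivlMr // !ltr_pdivrMr // !mulrDl mul1r.
  move=> /andP[h1 h2] /andP[h3 h4].
  by rewrite leNgt => /negP[]; rewrite ltr_norml; apply/andP; split; lra.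
rewrite -(size_map f) -(card_uniqP _) ?map_inj_in_uniq //.
by apply: leq_trans (max_card _) _; rewrite card_ffun !card_ord.
Qed.

(* If [s] represents distinct classes mod [2G], then [s + 2s + ... + 2^(k-1)s]
   consists of [#|s|^k] separated points in a box of side [O(2^k)], hence
   [#|s|^k = O(2^(nk))]. *)
Lemma card_mod2_closed (R : realType) (M : zmodType) n (c : 'I_n -> {additive M -> R})
    (G : zmodClosed M) (e : R) (s : seq M) :
  0 < e -> uniq s -> {subset s <= G} ->
  (forall x y g, x \in s -> y \in s -> g \in G -> x != y ->
     exists i, e <= `|c i (x - y - g *+ 2)|) ->
  (size s <= 2 ^ n)%N.
Proof.
move=> e0 us sG sep; rewrite leqNgt; apply/negP => ns.
have [B B0 sB] : exists2 B, 0 <= B & forall x i, x \in s -> `|c i x| <= B.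
  exists (\sum_(x <- s) \sum_i `|c i x|).
    by apply: sumr_ge0 => x _; apply: sumr_ge0.
  move=> x i xs; rewrite (big_rem x) //= (bigD1 i) //= -addrA lerDl.
  by rewrite addr_ge0 ?sumr_ge0 // => y _; rewrite sumr_ge0.
pose A k := iter k (fun t => [seq x + h *+ 2 | x <- s, h <- t]) [:: 0].
have AS k : A k.+1 = [seq x + h *+ 2 | x <- s, h <- A k] by [].
have szA k : size (A k) = (size s ^ k)%N.
  by elim: k => // k IH; rewrite AS size_allpairs IH expnS.
have AG k : {subset A k <= G}.
  elim: k => [|k IH] x; first by rewrite inE => /eqP->; rewrite rpred0.
  rewrite AS => /allpairsP[[y h] /= [ys hA ->]].
  by rewrite mulr2n !rpredD ?(sG _ ys) ?(IH _ hA).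
have AB k x i : x \in A k -> `|c i x| <= B * (2 ^+ k - 1).
  elim: k x => [|k IH] x.
    by rewrite inE => /eqP->; rewrite raddf0 normr0 expr0 subrr mulr0.
  rewrite AS => /allpairsP[[y h] /= [ys /IH hA ->]].
  rewrite raddfD raddfMn /= (le_trans (ler_normD _ _)) // normrMn.
  apply: (@le_trans _ _ (B + (B * (2 ^+ k - 1)) *+ 2)).
    by apply: lerD; [exact: sB|rewrite lerMn2r].
  rewrite exprS; lra.
have Asep k : uniq (A k) /\ forall x y, x \in A k -> y \in A k -> x != y ->
    exists i, e <= `|c i x - c i y|.
  elim: k => [|k [uk sk]].
    by split=> // x y; rewrite !inE => /eqP-> /eqP->; rewrite eqxx.
  (* Different lowest digits are separated by [sep] with [g = h' - h]; equal ones leave twice a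
     difference of elements of [A k], still of size at least [e]. *)
  have sk' : forall x x' h h', x \in s -> x' \in s -> h \in A k -> h' \in A k ->
      (x, h) != (x', h') -> exists i, e <= `|c i (x + h *+ 2) - c i (x' + h' *+ 2)|.
    move=> x x' h h' xs x's hA h'A; have [<-|xx'] := eqVneq x x'.
      rewrite xpair_eqE eqxx /= => hh'; have [i ei] := sk _ _ hA h'A hh'.
      exists i; rewrite -raddfB opprD addrACA subrr add0r -mulrnBl raddfMn raddfB.
      by rewrite normrMn (le_trans ei) // mulr2n lerDl.
    move=> _; have [i ei] := sep x x' (h' - h) xs x's (rpredB (AG _ _ h'A) (AG _ _ hA)) xx'.
    by exists i; rewrite -raddfB opprD addrACA; move: ei; rewrite mulrnBl opprB.
  split.
    rewrite AS; apply: allpairs_uniq => // -[x h] [x' h'].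
    move=> /allpairsP[[? ?] /= [xs hA [-> ->]]] /allpairsP[[? ?] /= [x's h'A [-> ->]]] E.
    apply/eqP; apply: contraT => /(sk' _ _ _ _ xs x's hA h'A)[i].
    by rewrite -/(_ + _) E subrr normr0 leNgt e0.
  move=> ? ?; rewrite AS => /allpairsP[[x h] /= [xs hA ->]] /allpairsP[[x' h'] /= [x's h'A ->]] ne.
  by apply: sk' => //; apply: contraNneq ne => -[-> ->].
pose K := (Num.truncn (2 * B / e)).+1.
have growth k : (size s ^ k <= (K * 2 ^ k) ^ n)%N.
  have [uk sk] := Asep k.
  rewrite -szA; apply: (@separated_size R _ n (fun i x => c i x) (B * 2 ^+ k) e) => //.
    have -> : 2 * (B * 2 ^+ k) / e = 2 * B / e * 2 ^+ k by ring.
    by rewrite natrM natrX ltr_pM2r ?exprn_gt0 // truncnS_gt.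
  move=> x i /AB /le_trans; apply; rewrite ler_wpM2l //; lra.
set b := (2 ^ n)%N in ns *.
have b0 : (0 < b)%N by rewrite expn_gt0.
(* Bernoulli's inequality [(1 + 1/b)^k >= 1 + k/b], cleared of denominators. *)
have bern k : (b ^ k * (b + k) <= b * b.+1 ^ k)%N.
  elim: k => [|k IH]; first by rewrite !expn0 addn0 mul1n muln1.
  rewrite !expnS.
  have : (b ^ k <= b.+1 ^ k)%N by case: k {IH} => // k; rewrite leq_exp2r.
  move: (b ^ k)%N (b.+1 ^ k)%N IH => p q h1 h2.
  have -> : (b * p * (b + k.+1) = b * (p * (b + k)) + b * p)%N by lia.
  have -> : (b * (b.+1 * q) = b * (b * q) + b * q)%N by lia.
  by rewrite leq_add // leq_mul2l ?h1 ?h2 orbT.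
(* With this [k], [growth] and [size s >= b + 1] would give [b + k <= b * K ^ n = k], against
   [b > 0]. *)
pose k := (b * K ^ n)%N.
have /= := bern k; apply/negP; rewrite -ltnNge.
apply: (@leq_ltn_trans (b * (b ^ k * K ^ n))).
  rewrite leq_mul2l; apply/orP; right.
  apply: (@leq_trans (size s ^ k)); first by case: (k) => // j; rewrite leq_exp2r // ltnW.
  by rewrite (leq_trans (growth k)) // expnMn mulnC leq_mul2r /b -!expnM mulnC leqnn orbT.
rewrite mulnCA ltn_pmul2l ?expn_gt0 ?b0 // -/k; lia.
Qed.

(** * Classes modulo the closure of 2G *)

Section QuotientProjection.
Local Open Scope quotient_scope.
Variables (M : zmodType) (I : zmodClosed M).
Local Notation Q := (Quotient.quot I).

Lemma quot_piD a b : \pi_Q (a + b) = \pi_Q a + \pi_Q b.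
Proof. exact: raddfD. Qed.

Lemma quot_piB a b : \pi_Q (a - b) = \pi_Q a - \pi_Q b.
Proof. exact: raddfB. Qed.

Lemma quot_piN a : \pi_Q (- a) = - \pi_Q a.
Proof. exact: raddfN. Qed.

Lemma quot_piMn a n : \pi_Q (a *+ n) = \pi_Q a *+ n.
Proof. exact: raddfMn. Qed.

Lemma quot_pi_eq0 a : (\pi_Q a == 0) = (a \in I).
Proof. by rewrite -[0](raddf0 \pi_Q) -Quotient.idealrBE subr0. Qed.

Lemma repr_piB a : repr (\pi_Q a) - a \in I.
Proof. by rewrite Quotient.idealrBE reprK. Qed.

End QuotientProjection.

Section DoubleClosure.
Local Open Scope quotient_scope.
Variables (R : realType) (M : zmodType) (n : nat) (c : 'I_n -> {additive M -> R}).
Variable G : zmodClosed M.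

(* The trace on [G] of the closure of [2G], in the coordinates [c]. *)
Definition double_closure : {pred M} := fun x =>
  (x \in G) && `[< forall e, 0 < e ->
    exists2 g, g \in G & forall i, `|c i (x - g *+ 2)| < e >].

Lemma double_closureP x : reflect
  (x \in G /\ forall e, 0 < e ->
     exists2 g, g \in G & forall i, `|c i (x - g *+ 2)| < e)
  (x \in double_closure).
Proof. by apply: (iffP andP) => -[xG /asboolP]. Qed.

Lemma double_closure_zmod : zmod_closed double_closure.
Proof.
split=> [|x y /double_closureP[xG hx] /double_closureP[yG hy]].
  apply/double_closureP; split=> [|e e0]; first exact: rpred0.
  by exists 0 => [|i]; rewrite ?rpred0 // mul0rn subrr raddf0 normr0.
apply/double_closureP; split=> [|e e0]; first exact: rpredB.
have e20 : 0 < e / 2 by rewrite divr_gt0.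
have [g gG hg] := hx _ e20; have [h hG hh] := hy _ e20.
exists (g - h) => [|i]; first exact: rpredB.
have -> : x - y - (g - h) *+ 2 = (x - g *+ 2) - (y - h *+ 2).
  by rewrite mulrnBl !opprB addrACA [RHS]addrACA [- y - _]addrC.
rewrite raddfB (le_lt_trans (ler_normB _ _)) // (splitr e).
by apply: ltrD.
Qed.

HB.instance Definition _ :=
  GRing.isZmodClosed.Build M double_closure double_closure_zmod.

Local Notation Q := (Quotient.quot double_closure).

(** The difference of two distinct representatives is not in the closure, which gives each pair its
    own separation; the least one over the finitely many pairs is uniform, as [card_mod2_closed]
    requires. *)
Lemma card_double_classes (s : seq Q) :
  uniq s -> (forall q, q \in s -> repr q \in G) -> (size s <= 2 ^ n)%N.
Proof.
move=> us sG; pose t := [seq repr q | q <- s].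
have ut : uniq t by rewrite map_inj_uniq //; apply: can_inj reprK.
have tG : {subset t <= G} by move=> _ /mapP[q qs ->]; apply: sG.
have ex_eps (p : M * M) : exists e, 0 < e /\
    (p.1 \in t -> p.2 \in t -> p.1 != p.2 -> forall g, g \in G ->
       exists i, e <= `|c i (p.1 - p.2 - g *+ 2)|).
  case: p => x y /=.
  have [[/mapP[p ps xE] [/mapP[q qs yE] xy]]|h] :=
      pselect (x \in t /\ y \in t /\ x != y); last first.
    by exists 1; split=> // xt yt xy; case: h.
  have : x - y \notin double_closure.
    rewrite (Quotient.idealrBE double_closure) xE yE !reprK.
    by apply: contraNneq xy => pq; rewrite xE yE pq.
  move=> /double_closureP K; apply: contrapT => noe; apply: K; split.
    by apply: rpredB; apply: tG; rewrite ?xE ?yE map_f.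
  move=> e e0; apply: contrapT => nog; apply: noe; exists e; split=> // _ _ _ g gG.
  apply: contrapT => noi; apply: nog; exists g => // i.
  by rewrite ltNge; apply/negP => ei; apply: noi; exists i.
have [eps epsP] := choice ex_eps.
pose e := \big[Num.min/1]_(p <- [seq (x, y) | x <- t, y <- t]) eps p.
have -> : size s = size t by rewrite size_map.
apply: (@card_mod2_closed R M n c G e) => //.
  by apply: lt_bigmin => // p _; exact: (epsP p).1.
move=> x y g xt yt gG xy; have [i ei] := (epsP (x, y)).2 xt yt xy g gG.
exists i; apply: le_trans ei; apply: ge_bigmin_seq => //.
by apply/allpairsP; exists (x, y).
Qed.

End DoubleClosure.

(** * Fano planes in subsets of an elementary abelian 2-group *)

Lemma count_predU_le (T : Type) (p q : pred T) s i j :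
  (count p s <= i)%N -> (count q s <= j)%N -> (count (predU p q) s <= i + j)%N.
Proof.
by move=> pi qj; apply: leq_trans (leq_add pi qj); rewrite -count_predUI leq_addr.
Qed.

Lemma exists_not_pred (T : eqType) (p : pred T) (s : seq T) :
  (count p s < size s)%N -> exists2 x, x \in s & ~~ p x.
Proof.
move=> ps; apply/hasP; rewrite has_predC all_count.
by move: ps; rewrite ltn_neqAle => /andP[].
Qed.

(* At most two nonzero classes lie outside [S], so each translate of [0 :: S]
   by an element of [H] leaves [0 :: S] in at most two points; hence [a], [b]
   and [c] can be chosen greedily. *)
Lemma exists_full_plane (Q : zmodType) (H : {pred Q}) (S : seq Q) :
  {in H &, forall x y, x + y \in H} -> {in H, forall x, x + x = 0} -> 0 \in H ->
  (forall s, uniq s -> {subset s <= H} -> (size s <= 16)%N) ->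
  uniq S -> {subset S <= H} -> 0 \notin S -> (13 <= size S)%N ->
  exists a b c, [/\ a \in S, b \in S & c \in S] /\
    [/\ a + b \in S, a + c \in S, b + c \in S & a + b + c \in S].
Proof.
move=> HD H2 H0 H16 uS SH S0 S13; pose P := 0 :: S.
have uP : uniq P by rewrite /= S0.
have PH x : x \in P -> x \in H by rewrite inE => /orP[/eqP->|/SH].
have P14 : (14 <= size P)%N by rewrite /= ltnS.
have miss g : g \in H -> (count (fun p => (g + p)%R \notin P) P <= 2)%N.
  move=> gH; pose s := P ++ [seq g + p | p <- P & g + p \notin P].
  have : (size s <= 16)%N.
    apply: H16; last first.
      move=> x; rewrite mem_cat => /orP[/PH//|/mapP[p]].
      by rewrite mem_filter => /andP[_ /PH pH] ->; apply: HD.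
    rewrite cat_uniq uP map_inj_uniq ?filter_uniq // andTb andbT.
    apply/hasPn => x /mapP[p].
    by rewrite mem_filter => /andP[gp _] ->.
  rewrite size_cat size_map size_filter; lia.
have cm x : (count (pred1 x) P <= 1)%N by rewrite count_uniq_mem // leq_b1.
have [a aS] : exists a, a \in S.
  by case: S S13 {uS SH S0 P uP PH P14 miss cm} => // a ? _; exists a; rewrite mem_head.
have aH := SH _ aS.
(* At most [2 + 1 + 1] elements of [P] are excluded here, and at most [3 * 2 + 4] in the choice of
   [c] below, while [P] has at least 14. *)
have [b bP] : exists2 b, b \in P &
    ~~ predU (fun p => a + p \notin P) (predU (pred1 0) (pred1 a)) b.
  apply: exists_not_pred; apply: leq_trans P14; rewrite ltnS.
  exact: leq_trans (count_predU_le (miss a aH) (count_predU_le (cm 0) (cm a))) _.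
move=> /norP[/negPn abP /norP[b0 ba]].
have SP x : x != 0 -> x \in P -> x \in S by rewrite inE => /negPf->.
have inS x y : x \in H -> y != x -> x + y \in P -> x + y \in S.
  move=> xH yx; apply: SP; apply: contraNneq yx => xy.
  by apply/eqP; apply: (addrI x); rewrite xy H2.
have bS : b \in S by apply: SP.
have abS : a + b \in S by apply: inS.
have bH := SH _ bS; have abH := SH _ abS.
pose bad1 := predU (fun p => a + p \notin P) (predU (fun p => b + p \notin P)
  (fun p => (a + b) + p \notin P)).
pose bad2 := predU (predU (pred1 0) (pred1 a)) (predU (pred1 b) (pred1 (a + b))).
have [c cP] : exists2 c, c \in P & ~~ predU bad1 bad2 c.
  have b1 := count_predU_le (miss a aH) (count_predU_le (miss b bH) (miss _ abH)).
  have b2 := count_predU_le (count_predU_le (cm 0) (cm a)) (count_predU_le (cm b) (cm (a + b))).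
  apply: exists_not_pred; apply: leq_trans P14; rewrite ltnS.
  exact: leq_trans (count_predU_le b1 b2) _.
move=> /norP[/norP[/negPn acP /norP[/negPn bcP /negPn abcP]]].
move=> /norP[/norP[c0 ca] /norP[cb cab]].
by exists a, b, c; split; split=> //; [exact: SP|exact: inS..].
Qed.

(* In the Fano plane generated by [a], [b] and [c], take for [x] and [y] the two
   points where [q] is largest, and for [z] the next one off the line [xy]. *)
Lemma exists_top_triangle (Q : zmodType) (q : Q -> nat) (S : seq Q) (a b c : Q) :
  {in S, forall x, x + x = 0} -> 0 \notin S -> {in S &, injective q} ->
  [/\ a \in S, b \in S & c \in S] ->
  [/\ a + b \in S, a + c \in S, b + c \in S & a + b + c \in S] ->
  exists x y z, [/\ x \in S, y \in S & z \in S] /\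
    [/\ x + y \in S /\ (q (x + y)%R < minn (q x) (q y))%N,
        x + z \in S /\ (q (x + z)%R < minn (q x) (q z))%N &
        y + z \in S /\ (q (y + z)%R < minn (q y) (q z))%N].
Proof.
move=> S2 S0 qinj [aS bS cS] [abS acS bcS abcS].
(* Points of the plane are coded by triples of bits, with sum [xo] and zero [o], so that incidences
   become Boolean computations. *)
pose T := (bool * bool * bool)%type.
pose F (t : T) := a *+ t.1.1 + b *+ t.1.2 + c *+ t.2.
pose xo (t u : T) : T := (t.1.1 (+) u.1.1, t.1.2 (+) u.1.2, t.2 (+) u.2).
pose o : T := (false, false, false).
have FD t u : F (xo t u) = F t + F u.
  have mul2 x (i j : bool) : x \in S -> x *+ (i (+) j) = x *+ i + x *+ j.
    by move=> /S2 x2; case: i j => -[]; rewrite /= ?mulr0n ?mulr1n ?addr0 ?add0r.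
  by rewrite /F /= !mul2 // [RHS]addrACA [X in _ = X + _]addrACA.
have FS t : t != o -> F t \in S.
  by case: t => [[[] []] []] // _; rewrite /F /= ?mulr0n ?mulr1n ?addr0 ?add0r.
have xoC t u : xo t u = xo u t by rewrite /xo addbC (addbC t.1.2) (addbC t.2).
have xoK t u : xo t (xo t u) = u.
  by case: t u => [[? ?] ?] [[? ?] ?]; rewrite /xo /= !addbA !addbb !addFb.
have xox t : xo t t = o by rewrite /xo !addbb.
have xo0 t : xo t o = t by rewrite -(xox t) xoK.
have xoo t u : (xo t u == o) = (t == u).
  by apply/eqP/eqP => [E|->//]; rewrite -(xoK t u) E xo0.
have xol t u : (xo t u == t) = (u == o).
  by apply/eqP/eqP => [E|->//]; rewrite -(xoK t u) E xox.
have xor t u : (xo t u == u) = (t == o) by rewrite xoC xol.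
have xoI t u v : (xo t u == xo t v) = (u == v).
  by apply/eqP/eqP => [E|->//]; rewrite -(xoK t u) E xoK.
have Finj t u : t != o -> u != o -> t != u -> q (F t) != q (F u).
  move=> t0 u0 tu; apply: contraNneq S0 => /qinj; rewrite !FS // => /(_ isT isT) E.
  by rewrite -(S2 (F u)) ?FS // -{1}E -FD FS // xoo.
have qlt t u : t != o -> u != o -> t != u -> (q (F t) <= q (F u))%N -> (q (F t) < q (F u))%N.
  by move=> t0 u0 tu le; rewrite ltn_neqAle le Finj.
pose B := [:: true; false].
have ex_out (P : pred T) :
    has P [seq (i, j) | i <- [seq (i, j) | i <- B, j <- B], j <- B] -> exists t, P t.
  by move=> /hasP[t _ Pt]; exists t.
have [x xP xmax] : exists2 x, x != o & forall t, t != o -> (q (F t) <= q (F x))%N.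
  by case: (@arg_maxnP T (true, true, true) (fun t => t != o) (q \o F)) => // x; exists x.
have [y yP ymax] : exists2 y, (y != o) && (y != x) &
    forall t, (t != o) && (t != x) -> (q (F t) <= q (F y))%N.
  have [y0 y0P] : exists y0, (y0 != o) && (y0 != x).
    by apply: ex_out; case: (x) => [[[] []] []].
  by case: (@arg_maxnP T y0 (fun t => (t != o) && (t != x)) (q \o F)) => // y; exists y.
pose out t := [&& t != o, t != x, t != y & t != xo x y].
have [z zP zmax] : exists2 z, out z & forall t, out t -> (q (F t) <= q (F z))%N.
  have [z0 z0P] : exists z0, out z0.
    by apply: ex_out; rewrite /out; case: (x) => [[[] []] []]; case: (y) => [[[] []] []].
  by case: (@arg_maxnP T z0 out (fun t => q (F t))) => // z; exists z.
exists (F x), (F y), (F z); rewrite -!FD.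
have [y0 yx] := andP yP; have [z0 zx zy zxy] := and4P zP.
have xy0 : xo x y != o by rewrite xoo eq_sym.
have xz0 : xo x z != o by rewrite xoo eq_sym.
have yz0 : xo y z != o by rewrite xoo eq_sym.
have xyx : xo x y != x by rewrite xol.
have xyy : xo x y != y by rewrite xor.
have xzx : xo x z != x by rewrite xol.
have xzz : xo x z != z by rewrite xor.
have yzy : xo y z != y by rewrite xol.
have yzz : xo y z != z by rewrite xor.
have yzx : xo y z != x by rewrite -(xoI y) xoK xoC.
(* [xo x z] and [xo y z] lie off the line through [x] and [y], so the maximality of [z] applies to
   them. *)
have outxz : out (xo x z) by rewrite /out xz0 xzx -(xoI x (xo x z)) xoK zxy xoI.
have outyz : out (xo y z) by rewrite /out yz0 yzx yzy (xoC x) xoI.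
split; first by split; apply: FS.
split; split; rewrite ?FS // leq_min; apply/andP; split; apply: qlt => //.
- exact: xmax.
- by apply: ymax; rewrite xy0.
- exact: xmax.
- exact: zmax.
- by apply: ymax; rewrite yz0.
- exact: zmax.
Qed.

(** * Strong kissing numbers *)

Section StrongKissing.
Variable R : realType.

Lemma row_dotE m (x y : 'rV[R]_m) : (x *m y^T) 0 0 = \sum_i x 0 i * y 0 i.
Proof. by rewrite mxE; apply: eq_bigr => i _; rewrite mxE. Qed.

(** An inner product below 1/2 means a squared distance above 1, so some coordinate differs by at
    least [1 / (m + 1)]; [separated_size] then applies in the cube [[-1, 1]^m]. *)
Lemma strict_spherical_code_bounded m :
  exists b, forall C : {fset 'rV[R]_m}, strict_spherical_code C -> (#|` C| <= b)%N.
Proof.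
exists ((2 * m.+1).+1 ^ m)%N => C [C1 C2].
have sq1 (x : 'rV[R]_m) : x \in C -> \sum_i x 0 i * x 0 i = 1.
  by move=> xC; rewrite -row_dotE C1.
pose e : R := m.+1%:R^-1.
have e0 : 0 < e by rewrite invr_gt0 ltr0n.
have em : m%:R * (e * e) <= 1.
  have h : e * m.+1%:R = 1 by rewrite mulVf // pnatr_eq0.
  have : 0 <= m%:R :> R by rewrite ler0n.
  rewrite -natr1 in h; nra.
have := @separated_size R _ m (fun i (x : 'rV[R]_m) => x 0 i) 1 e (2 * m.+1).+1
  (enum_fset C); apply=> //.
- by rewrite mulr1 invrK -natrM ltr_nat.
- exact: fset_uniq.
- move=> x i /sq1; rewrite (bigD1 i) //= => h.
  have : 0 <= \sum_(j < m | j != i) x 0 j * x 0 j.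
    by apply: sumr_ge0 => j _; rewrite -expr2 sqr_ge0.
  move=> h'; rewrite ler_norml; apply/andP; split; nra.
- move=> x y xC yC xy; apply: contrapT => noi.
  have lt_e i : `|x 0 i - y 0 i| < e.
    by rewrite ltNge; apply/negP => ei; apply: noi; exists i.
  have : \sum_i (x 0 i - y 0 i) * (x 0 i - y 0 i) <= m%:R * (e * e).
    rewrite -[X in X%:R * _]card_ord -sum1_card natr_sum mulr_suml.
    apply: ler_sum => i _; rewrite mul1r.
    by move: (lt_e i); rewrite ltr_norml => /andP[]; nra.
  have := C2 x y xC yC xy; rewrite row_dotE => h.
  suff -> : \sum_i (x 0 i - y 0 i) * (x 0 i - y 0 i) =
      1 + 1 - (\sum_i x 0 i * y 0 i) *+ 2 by lra.
  rewrite -{1}(sq1 x xC) -(sq1 y yC) -sumrMnl -big_split -sumrB /=.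
  by apply: eq_bigr => i _; ring.
Qed.

Lemma strong_kissingP m : is_strong_kissing R m (strong_kissing R m).
Proof.
suff [k kP] : exists k, is_strong_kissing R m k.
  by rewrite /strong_kissing; case: xgetP => [//|/(_ _ kP)].
pose P n := `[< exists2 C : {fset 'rV[R]_m}, strict_spherical_code C & #|` C| = n >].
have [b bP] := strict_spherical_code_bounded m.
have P0 : exists n, P n.
  exists 0; apply/asboolP; exists fset0; last exact: cardfs0.
  by split=> [x|x y]; rewrite in_fset0.
have Pb n : P n -> (n <= b)%N by move=> /asboolP[C /bP + <-].
case: (ex_maxnP P0 Pb) => k /asboolP kP kmax; exists k; split=> // C Ccode.
by apply: kmax; apply/asboolP; exists C.
Qed.

Lemma code_le_strong_kissing m (C : {fset 'rV[R]_m}) :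
  strict_spherical_code C -> (#|` C| <= strong_kissing R m)%N.
Proof. exact: (strong_kissingP m).2. Qed.

Lemma strong_kissing_gt0 m : (0 < strong_kissing R m.+1)%N.
Proof.
rewrite -(cardfs1 (delta_mx 0 0 : 'rV[R]_m.+1)); apply: code_le_strong_kissing.
split=> [x|x y]; rewrite !in_fset1 => /eqP->; last by move=> /eqP->; rewrite eqxx.
rewrite row_dotE (bigD1 0) //= big1 => [|i]; rewrite !mxE ?eqxx ?mulr1 ?addr0 //.
by move=> /negPf->; rewrite mulr0.
Qed.

Lemma strong_kissing1_le : (strong_kissing R 1 <= 2)%N.
Proof.
have [[C [C1 C2] <-] _] := strong_kissingP 1.
have : (C `<=` [fset const_mx 1; const_mx (-1)])%fset.
  apply/fsubsetP => x /C1; rewrite row_dotE big_ord1 -expr2 => /eqP.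
  rewrite sqrf_eq1 !inE => /orP[]/eqP h; apply/orP; [left|right];
    by apply/eqP/rowP => i; rewrite mxE (ord1 i).
by move=> /fsubset_leq_card /leq_trans; apply; rewrite cardfs2; case: eqP.
Qed.

(* Delsarte's method on the circle, with the extremal polynomial
   [(t - 1/2) (t + 1/2)^2 (t + 1)] for the angle 60 degrees, only gives [6];
   equality would force all inner products to be at most [-1/2]. *)
Lemma strong_kissing2_le : (strong_kissing R 2 <= 5)%N.
Proof.
have [[C [C1 C2] <-] _] := strong_kissingP 2.
rewrite leqNgt; apply/negP => C6.
pose a (x : 'rV[R]_2) := x 0 0; pose b (x : 'rV[R]_2) := x 0 1.
have dotE x y : (x *m y^T) 0 0 = a x * a y + b x * b y.
  rewrite row_dotE big_ord_recl big_ord1 /a /b.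
  by have -> : lift ord0 ord0 = 1 :> 'I_2 by apply: val_inj.
pose p t : R := (t - 2^-1) * (t + 2^-1) ^+ 2 * (t + 1).
pose d x y := a x * a y + b x * b y.
pose s := enum_fset C.
have cir x : x \in s -> a x ^+ 2 + b x ^+ 2 = 1.
  by move=> /C1; rewrite dotE -!expr2.
have sep x y : x \in s -> y \in s -> x != y -> d x y < 2^-1.
  by move=> xC yC xy; rewrite /d -dotE C2.
have dge x y : x \in s -> y \in s -> -1 <= d x y.
  move=> /cir hx /cir hy; rewrite /d.
  have := sqr_ge0 (a x + a y); have := sqr_ge0 (b x + b y); lra.
(* The [c] and [s] functions are the cosines and sines of the first four multiples of the polar
   angle, as polynomials in [a] and [b]. *)
pose c1 x := a x; pose s1 x := b x.
pose c2 x := a x ^+ 2 - b x ^+ 2; pose s2 x := 2 * a x * b x.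
pose c3 x := a x ^+ 3 - 3 * a x * b x ^+ 2; pose s3 x := 3 * a x ^+ 2 * b x - b x ^+ 3.
pose c4 x := c2 x ^+ 2 - s2 x ^+ 2; pose s4 x := 2 * c2 x * s2 x.
(* Chebyshev expansion of [p], with nonnegative coefficients: [T_k (d x y)] is
   [c_k x * c_k y + s_k x * s_k y]. *)
have pE x y : x \in s -> y \in s -> p (d x y) = 3 / 8 + 3 / 4 * (c1 x * c1 y + s1 x * s1 y)
    + 5 / 8 * (c2 x * c2 y + s2 x * s2 y) + 3 / 8 * (c3 x * c3 y + s3 x * s3 y)
    + 1 / 8 * (c4 x * c4 y + s4 x * s4 y).
  move=> /cir hx /cir hy.
  have T2 : c2 x * c2 y + s2 x * s2 y = 2 * d x y ^+ 2 - 1.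
    transitivity (2 * d x y ^+ 2 - (a x ^+ 2 + b x ^+ 2) * (a y ^+ 2 + b y ^+ 2)).
      by rewrite /c2 /s2 /d; ring.
    by rewrite hx hy mulr1.
  have T3 : c3 x * c3 y + s3 x * s3 y = 4 * d x y ^+ 3 - 3 * d x y.
    transitivity (4 * d x y ^+ 3 -
        3 * d x y * ((a x ^+ 2 + b x ^+ 2) * (a y ^+ 2 + b y ^+ 2))).
      by rewrite /c3 /s3 /d; ring.
    by rewrite hx hy !mulr1.
  have T4 : c4 x * c4 y + s4 x * s4 y = 8 * d x y ^+ 4 - 8 * d x y ^+ 2 + 1.
    transitivity (2 * (c2 x * c2 y + s2 x * s2 y) ^+ 2 -
        ((c2 x ^+ 2 + s2 x ^+ 2) * (c2 y ^+ 2 + s2 y ^+ 2))).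
      by rewrite /c4 /s4; ring.
    have n2 z : a z ^+ 2 + b z ^+ 2 = 1 -> c2 z ^+ 2 + s2 z ^+ 2 = 1.
      move=> hz; rewrite -[RHS](expr1n _ 2) -hz /c2 /s2; ring.
    rewrite !n2 // T2; ring.
  by rewrite T2 T3 T4 /c1 /s1 -/(d x y) /p; field.
have sumE (f : R) (u v : 'rV[R]_2 -> R) :
    \sum_(x <- s) \sum_(y <- s) f * (u x * u y + v x * v y) =
    f * ((\sum_(x <- s) u x) ^+ 2 + (\sum_(x <- s) v x) ^+ 2).
  rewrite !expr2 !big_distrlr /= -big_split mulr_sumr; apply: eq_bigr => x _.
  by rewrite -big_split mulr_sumr.
have us : uniq s := fset_uniq C.
have N6 : 6 <= (size s)%:R :> R by rewrite ler_nat.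
(* The nonconstant terms add up to sums of squares; only the constant coefficient [3 / 8]
   remains. *)
have total : (size s)%:R ^+ 2 * (3 / 8) <= \sum_(x <- s) \sum_(y <- s) p (d x y).
  have -> : \sum_(x <- s) \sum_(y <- s) p (d x y) =
      \sum_(x <- s) \sum_(y <- s) (3 / 8 + 3 / 4 * (c1 x * c1 y + s1 x * s1 y)
      + 5 / 8 * (c2 x * c2 y + s2 x * s2 y) + 3 / 8 * (c3 x * c3 y + s3 x * s3 y)
      + 1 / 8 * (c4 x * c4 y + s4 x * s4 y)).
    by apply: eq_big_seq => x xs; apply: eq_big_seq => y ys; rewrite pE.
  under eq_bigr => x _ do rewrite !big_split /=.
  rewrite !big_split /= !sumE.
  have -> : \sum_(x <- s) \sum_(y <- s) (3 / 8) = (size s)%:R ^+ 2 * (3 / 8) :> R.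
    by rewrite expr2 -mulrA !mulr_natl !big_const_seq !count_predT !iter_addr_0.
  by rewrite -!addrA lerDl !addr_ge0 // mulr_ge0 ?divr_ge0 ?addr_ge0 ?sqr_ge0.
have p_le0 x y : x \in s -> y \in s -> x != y -> p (d x y) <= 0.
  move=> xs ys xy; have l := dge x y xs ys; have u := sep x y xs ys xy.
  rewrite /p -mulrA nmulr_rle0 ?subr_lt0 // mulr_ge0 ?sqr_ge0 //; lra.
have row_le x : x \in s -> \sum_(y <- s) p (d x y) <= 9 / 4.
  move=> xs; rewrite (big_rem x) //=.
  have -> : p (d x x) = 9 / 4 by rewrite /d -!expr2 (cir x xs) /p; field.
  rewrite gerDl big_seq; apply: sumr_le0 => y; rewrite mem_rem_uniq // !inE.
  by move=> /andP[yx ys]; rewrite p_le0 // eq_sym.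
(* As [p 1 = 9 / 4], six points already make [total] tight; a pair with inner product in
   [(-1/2, 1/2)], where [p] is negative, would break it. *)
have far x y : x \in s -> y \in s -> x != y -> d x y <= - 2^-1.
  move=> xs ys xy; rewrite leNgt; apply/negP => gt.
  have : p (d x y) < 0.
    have u := sep x y xs ys xy.
    rewrite /p -mulrA nmulr_rlt0 ?subr_lt0 // mulr_gt0 ?exprn_gt0 //; lra.
  have : \sum_(z <- s) p (d x z) <= 9 / 4 + p (d x y).
    have yr : y \in rem x s by rewrite mem_rem_uniq // inE eq_sym xy.
    rewrite (big_rem x) //= (big_rem y yr) /=.
    have -> : p (d x x) = 9 / 4 by rewrite /d -!expr2 (cir x xs) /p; field.
    rewrite lerD2l gerDl big_seq; apply: sumr_le0 => z /mem_rem.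
    rewrite mem_rem_uniq // !inE => /andP[zx zs]; rewrite p_le0 // eq_sym //.
  have : \sum_(z <- rem x s) \sum_(y <- s) p (d z y) <= (9 / 4) *+ (size s).-1.
    rewrite -(size_rem xs) -iter_addr_0 -count_predT -big_const_seq big_seq [leRHS]big_seq.
    by apply: ler_sum => z /mem_rem; exact: row_le.
  move: total; rewrite (big_rem x) //= -[_ *+ (size s).-1]mulr_natr.
  have -> : (size s).-1%:R = (size s)%:R - 1 :> R.
    by case: (s) xs => //= ? t _; rewrite -natr1 addrK.
  nra.
(* The sum of all inner products is the squared norm of the sum of the points, but each row is at
   most [1 - (size s - 1) / 2], hence below [- (1 / 4)]. *)
have : 0 <= \sum_(x <- s) \sum_(y <- s) 1 * (c1 x * c1 y + s1 x * s1 y).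
  by rewrite sumE mul1r addr_ge0 ?sqr_ge0.
apply/negP; rewrite -ltNge.
apply: (@le_lt_trans _ _ ((- (1 / 4)) *+ size s)); last first.
  by rewrite -[_ *+ size s]mulr_natr; nra.
rewrite -iter_addr_0 -count_predT -big_const_seq big_seq [leRHS]big_seq.
apply: ler_sum => x xs; rewrite (big_rem x) //= mul1r -!expr2 (cir x xs).
have : \sum_(y <- rem x s) 1 * (c1 x * c1 y + s1 x * s1 y) <= (- 2^-1) *+ (size s).-1.
  rewrite -(size_rem xs) -iter_addr_0 -count_predT -big_const_seq big_seq [leRHS]big_seq.
  apply: ler_sum => y; rewrite mem_rem_uniq // !inE => /andP[yx ys].
  by rewrite mul1r far // eq_sym.
rewrite -[_ *+ (size s).-1]mulr_natr.
have -> : (size s).-1%:R = (size s)%:R - 1 :> R.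
  by case: (s) xs => //= ? t _; rewrite -natr1 addrK.
nra.
Qed.

End StrongKissing.

(** Dimension 0 has no unit vector; this is what rules out two near returns in effective dimension
    0. *)
Lemma strong_kissing0 (R : realType) : strong_kissing R 0 = 0%N.
Proof.
have [[C [C1 _] <-] _] := strong_kissingP R 0.
apply/eqP; rewrite cardfs_eq0; apply/eqP/fsetP => x; rewrite in_fset0.
apply/negP => /C1; rewrite row_dotE big_ord0 => /esym/eqP.
by rewrite oner_eq0.
Qed.

(** * Configurations of near returns *)

Lemma subr_mulrzB (M : zmodType) (x y c : M) (k l : int) :
  (x - c *~ k) - (y - c *~ l) = (x - y) - c *~ (k - l).
Proof.
by rewrite mulrzBr !opprB addrACA [RHS]addrACA; congr (_ + _); rewrite addrC.
Qed.

(** * Gram-Schmidt expansions and obtuse triples *)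

Section InnerGeometry.
Variables (R : realType) (V : innerVectType R).
Implicit Types (u v x y z : V) (E : {vspace V}).

Lemma inorm_sqr v : inorm v ^+ 2 = inner v v.
Proof. by rewrite sqr_sqrtr ?inner_ge0. Qed.

Lemma innerDl u v x : inner (u + v) x = inner u x + inner v x.
Proof. by rewrite linearDl. Qed.

Lemma innerBl u v x : inner (u - v) x = inner u x - inner v x.
Proof. by rewrite linearDl linearNl. Qed.

Lemma innerBr u v x : inner x (u - v) = inner x u - inner x v.
Proof. by rewrite innerC innerBl !(innerC x). Qed.

Lemma innerZl a u x : inner (a *: u) x = a * inner u x.
Proof. by rewrite linearZl_LR. Qed.

Lemma innerZr a u x : inner x (a *: u) = a * inner x u.
Proof. by rewrite innerC innerZl innerC. Qed.

Lemma inner_suml (I : Type) (r : seq I) (F : I -> V) x :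
  inner (\sum_(i <- r) F i) x = \sum_(i <- r) inner (F i) x.
Proof. by rewrite linear_sumlz. Qed.

Lemma inner_sumr (I : Type) (r : seq I) (F : I -> V) x :
  inner x (\sum_(i <- r) F i) = \sum_(i <- r) inner x (F i).
Proof. by rewrite linear_sumr. Qed.

Lemma innerBB u v : inner (u - v) (u - v) = inner u u - inner u v *+ 2 + inner v v.
Proof. by rewrite innerBl !innerBr (innerC v u); ring. Qed.

Lemma inorm_double v : inorm (v *+ 2) = 2 * inorm v.
Proof.
apply: (@pexpIrn _ 2) => //; rewrite ?nnegrE ?mulr_ge0 ?inorm_ge0 //.
by rewrite exprMn !inorm_sqr mulr2n innerDD; ring.
Qed.

Lemma inorm_lt v (D : R) : 0 <= D -> (inorm v < D) = (inner v v < D ^+ 2).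
Proof. by move=> D0; rewrite -inorm_sqr ltr_pXn2r ?nnegrE ?inorm_ge0. Qed.

Lemma inorm_ge v (D : R) : 0 <= D -> (D <= inorm v) = (D ^+ 2 <= inner v v).
Proof. by move=> D0; rewrite leNgt inorm_lt // -leNgt. Qed.

(** Gram-Schmidt; a dependent vector contributes 0, because [0^-1 = 0], and the expansion formula
    tolerates such zeros in [o]. *)
Lemma orthonormal_seq (s : seq V) : exists o : seq V,
  [/\ size o = size s, {subset o <= <<s>>%VS} &
      {in <<s>>%VS, forall u, u = \sum_(x <- o) inner u x *: x}].
Proof.
elim: s => [|b s [o [so os oE]]].
  by exists [::]; split=> // u; rewrite span_nil memv0 big_nil => /eqP.
pose f := \sum_(x <- o) inner b x *: x; pose g := b - f.
have fs : f \in <<s>>%VS.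
  by rewrite /f big_seq; apply: memv_suml => x /os xs; apply: memvZ.
have g0 u : u \in <<s>>%VS -> inner g u = 0.
  move=> us; rewrite innerBl; apply/eqP; rewrite subr_eq0; apply/eqP.
  rewrite {1}(oE u us) inner_sumr /f inner_suml.
  by apply: eq_bigr => x _; rewrite innerZl innerZr (innerC x) mulrC.
exists ((inorm g)^-1 *: g :: o); split=> [|x|u]; first by rewrite /= so.
  have sub := subvP (addvSr <[b]> <<s>>%VS).
  rewrite span_cons inE => /orP[/eqP->|/os /sub //].
  apply/memvZ/memvB; last exact: sub.
  by apply: (subvP (addvSl _ _)); exact: memv_line.
rewrite span_cons => /memv_addP[_ /vlineP[t ->] [y ys ->]].
have -> : t *: b + y = t *: g + (t *: f + y) by rewrite scalerBr addrA subrK.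
set y' := t *: f + y; have y's : y' \in <<s>>%VS by rewrite memvD // memvZ.
move: y' y's => y' y's; rewrite big_cons; congr (_ + _).
  rewrite innerZr innerDl innerZl (innerC y') (g0 _ y's) addr0 scalerA.
  have [->|gn0] := eqVneq g 0; first by rewrite !scaler0.
  congr (_ *: _); rewrite -inorm_sqr.
  have : inorm g != 0 by apply: contra_neq gn0; exact: inorm_eq0.
  by move=> ?; field.
rewrite {1}(oE y' y's) big_seq [RHS]big_seq; apply: eq_bigr => x /os xs.
by rewrite innerDl innerZl g0 // mulr0 add0r.
Qed.

Lemma orthonormal_family E : exists o : 'I_(\dim E) -> V,
  (forall i, o i \in E) /\ {in E, forall u, u = \sum_i inner u (o i) *: o i}.
Proof.
have [o [so os oE]] := orthonormal_seq (vbasis E).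
move: so; rewrite size_tuple => so.
have sE : <<vbasis E>>%VS = E by exact: span_basis (vbasisP E).
rewrite sE in os oE; exists (fun i => o`_i); split=> [i|u uE].
  by apply: os; rewrite mem_nth // so.
by rewrite {1}(oE u uE) (big_nth 0) so big_mkord.
Qed.

Lemma parseval E (o : 'I_(\dim E) -> V) :
  {in E, forall u, u = \sum_i inner u (o i) *: o i} ->
  {in E, forall u v, inner u v = \sum_i inner u (o i) * inner v (o i)}.
Proof.
move=> oE u uE v; rewrite {1}(oE u uE) inner_suml.
by apply: eq_bigr => i _; rewrite innerZl (innerC v).
Qed.

(** Adding the last two hypotheses, the parallelogram law gives
    [|p - q|^2 >= 4 D^2 - |i|^2 > 3 D^2]. *)
Lemma obtuse_of_far (D : R) (p q i : V) :
  inner p p < D ^+ 2 -> inner q q < D ^+ 2 -> inner i i < D ^+ 2 ->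
  (D + D) ^+ 2 <= inner (i + p - q) (i + p - q) ->
  (D + D) ^+ 2 <= inner (i + q - p) (i + q - p) -> inner p q *+ 2 < - D ^+ 2.
Proof. by rewrite !innerBB !innerDD !innerDl (innerC q p); lra. Qed.

(** Otherwise [|x + y + z|^2 < 3 D^2 - 3 D^2 = 0]. *)
Lemma no_obtuse_triangle (D : R) x y z :
  inner x x < D ^+ 2 -> inner y y < D ^+ 2 -> inner z z < D ^+ 2 ->
  inner x y *+ 2 < - D ^+ 2 -> inner x z *+ 2 < - D ^+ 2 ->
  inner y z *+ 2 < - D ^+ 2 -> False.
Proof.
by have := inner_ge0 (x + y + z); rewrite !innerDD !innerDl; lra.
Qed.

End InnerGeometry.

(** * Two bounds on the number of near returns *)

Section Configuration.
Local Open Scope quotient_scope.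
(* [G] stands for the pairs [(v, k)] such that some [(v, u)] with [u] small lifts
   [k * alpha]; [f] is the component of [alpha] orthogonal to [E]. *)
Variables (R : realType) (V : innerVectType R) (E : {vspace V}) (f : V).
Variables (G : zmodClosed (V * int)%type) (D : R) (h : nat).
Hypothesis GE : forall v (k : int), (v, k) \in G -> v - f *~ k \in E.
Hypothesis G_far : forall v (k : nat),
  (v, k%:Z) \in G -> (0 < k <= h)%N -> D <= inorm v.
Variables (w : nat -> V) (s : seq nat).
Hypothesis s_uniq : uniq s.
Hypothesis s_range : forall q, q \in s -> (h < q <= h + h)%N.
Hypothesis wG : forall q, q \in s -> (w q, q%:Z) \in G.
Hypothesis w_near : forall q, q \in s -> inorm (w q) < D.

Let D_gt0 q : q \in s -> 0 < D.
Proof. by move=> /w_near; apply: le_lt_trans (inorm_ge0 _). Qed.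

(** Write [w q = e q + q f]. For [p < q] one has [q - p <= h < p], so the [f] part of [w q - w p] is
    no longer than that of [w p] or [w q], while [|w q - w p| >= D] exceeds both norms. Hence
    [|e q - e p|] exceeds [|e p|] and [|e q|]: the angle is above 60 degrees. *)
Lemma size_le_strong_kissing : {in E, forall u, inner f u = 0} ->
  (1 < size s)%N -> (size s <= strong_kissing R (\dim E))%N.
Proof.
move=> fE s1; pose e q := w q - f *~ q.
have eE q : q \in s -> e q \in E by move=> qs; apply: GE; apply: wG.
have wE q : q \in s -> inner (w q) (w q) = q%:R ^+ 2 * inner f f + inner (e q) (e q).
  move=> /eE eqE; have -> : w q = e q + q%:R *: f.
    by rewrite /e scaler_nat -pmulrn subrK.
  by rewrite innerDD innerZr innerZl innerZr (innerC _ f) fE //; ring.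
have far p q : p \in s -> q \in s -> (p < q)%N ->
    inner (e p) (e p) < inner (e q - e p) (e q - e p) /\
    inner (e q) (e q) < inner (e q - e p) (e q - e p).
  move=> ps qs pq; have /andP[hp p2] := s_range ps; have /andP[hq q2] := s_range qs.
  have D0 := D_gt0 qs.
  have kG : (w q - w p, (q - p)%N%:Z) \in G.
    by rewrite -subzn ?(ltnW pq) //; exact: (rpredB (wG qs) (wG ps)).
  have := G_far kG; rewrite (_ : (0 < q - p <= h)%N); last by lia.
  move=> /(_ isT); rewrite inorm_ge ?(ltW D0) //.
  have -> : w q - w p = (e q - e p) + (q - p)%:R *: f.
    rewrite /e scaler_nat -!pmulrn mulrnBr ?(ltnW pq) //.
    by rewrite opprB -addrA [_ - w p + _]addrC !subrKA.
  have edE : e q - e p \in E by rewrite memvB ?eE.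
  rewrite innerDD innerZr innerZl innerZr (innerC _ f) fE // mulr0 mul0rn addr0.
  have := w_near ps; have := w_near qs; rewrite !inorm_lt ?(ltW D0) // !wE //.
  have F0 := inner_ge0 f; rewrite natrB ?(ltnW pq) //.
  have : p%:R <= q%:R :> R by rewrite ler_nat ltnW.
  have : q%:R <= p%:R + p%:R :> R by rewrite -natrD ler_nat; lia.
  have : 0 <= p%:R :> R by [].
  move: (p%:R : R) (q%:R : R) => P Q P0 QP PQ.
  have : (Q - P) ^+ 2 * inner f f <= P ^+ 2 * inner f f.
    by rewrite ler_wpM2r // ler_sqr ?nnegrE; lra.
  have : (Q - P) ^+ 2 * inner f f <= Q ^+ 2 * inner f f.
    by rewrite ler_wpM2r // ler_sqr ?nnegrE; lra.
  rewrite mulrA -expr2; lra.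
have {}far p q : p \in s -> q \in s -> p != q ->
    inner (e p) (e p) < inner (e p - e q) (e p - e q).
  move=> ps qs; rewrite neq_ltn => /orP[] lt; last by case: (far q p qs ps lt).
  by case: (far p q ps qs lt) => + _; rewrite -(opprB (e p)) -!inorm_sqr inormN.
(* Here [1 < size s] enters: with a second index [p], [e q = 0] would contradict [far p q]. *)
have e_neq0 q : q \in s -> 0 < inorm (e q).
  move=> qs; have [p ps pq] : exists2 p, p \in s & p != q.
    case: (s) s_uniq s1 qs => [|a [|b t]] //= /andP[+ _] _ _.
    rewrite inE negb_or => /andP[ab _]; have [<-|aq] := eqVneq a q.
      by exists b; rewrite ?inE ?eqxx ?orbT // eq_sym.
    by exists a; rewrite ?inE ?eqxx.
  rewrite lt_neqAle inorm_ge0 andbT eq_sym; apply/eqP => /inorm_eq0 e0.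
  by have := far p q ps qs pq; rewrite e0 subr0 ltxx.
have cos p q : p \in s -> q \in s -> p != q ->
    inner (e p) (e q) / (inorm (e p) * inorm (e q)) < 2^-1.
  move=> ps qs pq; have := far p q ps qs pq.
  have := far q p qs ps; rewrite eq_sym pq => /(_ isT).
  have := e_neq0 p ps; have := e_neq0 q qs.
  rewrite (innerBB (e p)) (innerBB (e q)) (innerC (e q) (e p)) -!inorm_sqr => P0 Q0 h1 h2.
  rewrite ltr_pdivrMr ?mulr_gt0 //.
  by have [le|/ltW le] := lerP (inorm (e p)) (inorm (e q)); nra.
have [o [_ oE]] := orthonormal_family E.
pose phi q : 'rV[R]_(\dim E) := \row_i (inner (e q) (o i) / inorm (e q)).
have phiE p q : p \in s -> q \in s ->
    (phi p *m (phi q)^T) 0 0 = inner (e p) (e q) / (inorm (e p) * inorm (e q)).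
  move=> ps qs; rewrite row_dotE (parseval oE (eE _ ps)) mulr_suml.
  by apply: eq_bigr => i _; rewrite !mxE invfM mulrACA.
have phi1 q : q \in s -> (phi q *m (phi q)^T) 0 0 = 1.
  move=> qs; rewrite phiE // -inorm_sqr expr2 divff //.
  by rewrite mulf_neq0 // gt_eqF // e_neq0.
have phi_inj : {in s &, injective phi}.
  move=> p q ps qs pq; apply/eqP; apply: contraT => /(cos p q ps qs).
  by rewrite -phiE // pq phi1 // ltNge invf_le1 ?ler1n.
pose C := [fset phi q | q in s]%fset.
have <- : #|` C| = size s.
  by rewrite card_in_imfset /=; [rewrite undup_id|].
apply: code_le_strong_kissing; split=> [_ /imfsetP[q /= qs ->]|]; first exact: phi1.
move=> _ _ /imfsetP[p /= ps ->] /imfsetP[q /= qs ->] pq; rewrite phiE //.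
by apply: cos => //; apply: contra_neq pq => ->.
Qed.

Variable o : 'I_(\dim E) -> V.
Hypothesis oE : {in E, forall u, u = \sum_i inner u (o i) *: o i}.

(** Coordinate [ord0] is the index [k], the others are those of [v - k f] in [E]. There are
    [\dim E + 1] of them, whence at most [2 ^ 4] classes in dimension 3. *)
Definition lattice_coord (i : 'I_(\dim E).+1) (a : V * int) : R :=
  if unlift ord0 i is Some j then inner (a.1 - f *~ a.2) (o j) else a.2%:~R.

Lemma lattice_coord_additive i : zmod_morphism (lattice_coord i).
Proof.
move=> [u k] [v l]; rewrite /lattice_coord; case: unliftP => [j|] _ /=.
  by rewrite -innerBl subr_mulrzB.
exact: mulrzBr.
Qed.

HB.instance Definition _ i :=
  GRing.isZmodMorphism.Build (V * int)%type R (lattice_coord i)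
    (lattice_coord_additive i).

Local Notation K := (double_closure lattice_coord G).
Local Notation Q := (Quotient.quot K).

(** If [(v, k)] is near [2 (g, l)], then [l = k / 2] lies in [(0, h]], so [|g| >= D] and [|v|] falls
    short of [2 D] by as little as desired. *)
Lemma double_closure_far v (k : nat) :
  (v, k%:Z) \in K -> (0 < k <= h + h)%N -> 0 < D -> D + D <= inorm v.
Proof.
move=> /double_closureP[vG vK] kh D0; rewrite leNgt; apply/negP => vD.
pose m := \dim E; pose eta := D + D - inorm v.
have eta0 : 0 < eta by rewrite subr_gt0.
(* The bound [1] forces the integers [k] and [2 l] to agree; the other one keeps [|v - 2 g|], at
   most [e * m], below [eta]. *)
pose e := Num.min 1 (eta / m.+1%:R).
have e0 : 0 < e by rewrite lt_min ltr01 divr_gt0.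
have [[g l] gG ge] := vK e e0.
have kl : k%:Z = l *+ 2.
  have : `|(k%:Z - l *+ 2)%:~R : R| < 1.
    have := ge ord0; rewrite /= /lattice_coord unlift_none => /lt_le_trans; apply.
    by rewrite ge_min lexx.
  rewrite -intr_norm -[1]/(1%:~R) ltr_int mulr2n; lia.
have vgE : v - g *+ 2 \in E.
  have := GE (rpredB vG (rpredD gG gG)).
  by rewrite /= -mulr2n kl subrr mulr0z subr0.
have vg : inorm (v - g *+ 2) < eta.
  have em0 : e * m%:R < eta.
    apply: (@lt_le_trans _ _ (e * m.+1%:R)); first by rewrite ltr_pM2l // ltr_nat.
    by rewrite -ler_pdivlMr // ge_min lexx orbT.
  apply: le_lt_trans em0; rewrite -(@ler_pXn2r _ 2) ?nnegrE ?inorm_ge0 ?mulr_ge0 ?(ltW e0) //.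
  rewrite inorm_sqr (parseval oE vgE).
  apply: (@le_trans _ _ (\sum_(i < m) e ^+ 2)).
    apply: ler_sum => i _; rewrite -expr2 -ler_sqrt ?exprn_ge0 ?(ltW e0) // !sqrtr_sqr.
    have := ge (lift ord0 i); rewrite /= /lattice_coord liftK /= mulr2n kl subrr mulr0z subr0.
    by rewrite (gtr0_norm e0); exact: ltW.
  rewrite sumr_const card_ord -[leLHS]mulr_natr exprMn ler_wpM2l ?exprn_ge0 ?(ltW e0) //.
  by rewrite -natrX ler_nat -mulnn; case: (m) => // j; rewrite leq_pmulr.
have [j lE] : exists j : nat, l = j by case: l {gG ge vgE vg} kl => [j|j] kl; [exists j | lia].
have jh : (0 < j <= h)%N by rewrite lE mulr2n in kl; lia.
have gD : D <= inorm g by apply: G_far jh; rewrite -lE.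
have : inorm (g *+ 2) <= inorm v + inorm (v - g *+ 2).
  by rewrite -(inormN (v - _)) (le_trans _ (inormD _ _)) // opprB addrC subrK.
rewrite inorm_double /eta in vg *; lra.
Qed.

Lemma size_le_parity : \dim E = 3 -> (size s <= 12)%N.
Proof.
move=> dE; rewrite leqNgt; apply/negP => s13.
have D0 : 0 < D.
  by apply: (@D_gt0 (head 0%N s)); rewrite -nth0 mem_nth // (leq_trans _ s13).
pose W q : V * int := (w q, q%:Z).
pose S := [seq \pi_Q (W q) | q <- s].
have KG : {subset K <= G} by move=> a /double_closureP[].
(* [H] is the image of [G]; since [K] lies in [G], membership can be tested on any
   representative. *)
pose H : {pred Q} := fun x => repr x \in G.
have HE a : (\pi_Q a \in H) = (a \in G).
  rewrite unfold_in -[X in X \in G](subrK a) rpredDl //.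
  by apply: KG; exact: repr_piB.
have HD : {in H &, forall x y, x + y \in H}.
  by move=> x y xH yH; rewrite -[x]reprK -[y]reprK -quot_piD HE rpredD.
have H2 : {in H, forall x, x + x = 0}.
  move=> x xH; apply/eqP; rewrite -[x]reprK -quot_piD quot_pi_eq0.
  apply/double_closureP; split=> [|e e0]; first exact: rpredD.
  by exists (repr x) => // i; rewrite mulr2n subrr raddf0 normr0.
(* [|w q - w p| < 2 D] with [0 < q - p <= 2 h], so [double_closure_far] keeps this difference out of
   [K]. *)
have far p q : p \in s -> q \in s -> (p < q)%N -> \pi_Q (W p) != \pi_Q (W q).
  move=> ps qs pq; rewrite eq_sym -subr_eq0 -quot_piB quot_pi_eq0; apply/negP => K0.
  have {}K0 : (w q - w p, (q - p)%N%:Z) \in K by rewrite -subzn // ltnW.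
  have := double_closure_far K0; have /andP[_ q2] := s_range qs.
  rewrite subn_gt0 pq (leq_trans (leq_subr _ _) q2) => /(_ isT D0).
  rewrite leNgt => /negP[]; apply: le_lt_trans (inormD _ _) _.
  by rewrite inormN ltrD ?w_near.
have pi_inj : {in s &, injective (\pi_Q \o W)}.
  move=> p q ps qs /= pq; apply/eqP; apply: contraT; rewrite neq_ltn.
  by move=> /orP[/far|/far] /(_ _ _)/eqP; case; rewrite // pq.
have uS : uniq S by rewrite map_inj_in_uniq.
have SH : {subset S <= H} by move=> _ /mapP[q qs ->]; rewrite HE wG.
have S0 : 0 \notin S.
  apply/negP => /mapP[q qs /esym/eqP]; rewrite quot_pi_eq0 => K0.
  have /andP[hq q2] := s_range qs.
  have := double_closure_far K0; rewrite q2 (leq_ltn_trans _ hq) // => /(_ isT D0).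
  by rewrite leNgt (lt_le_trans (w_near qs)) // lerDl ltW.
have H16 t : uniq t -> {subset t <= H} -> (size t <= 16)%N.
  by move=> ut tH; have /leq_trans := card_double_classes ut tH; apply; rewrite dE.
have H0 : 0 \in H by rewrite -[0](raddf0 \pi_Q) HE rpred0.
have S13 : (13 <= size S)%N by rewrite size_map.
have [a [b [c [abcS planeS]]]] := exists_full_plane HD H2 H0 H16 uS SH S0 S13.
pose r x := nth 0%N s (index x S).
have rS x : x \in S -> r x \in s.
  by move=> xS; rewrite mem_nth // -(size_map (\pi_Q \o W)) index_mem.
have rK x : x \in S -> \pi_Q (W (r x)) = x.
  move=> xS; rewrite -[LHS](nth_map _ 0 (\pi_Q \o W)) ?nth_index //.
  by rewrite -(size_map (\pi_Q \o W)) index_mem.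
have r_inj : {in S &, injective r}.
  by move=> x y xS yS xy; rewrite -(rK x xS) -(rK y yS) xy.
have S2 : {in S, forall x, x + x = 0} by move=> x /SH /H2.
have [x [y [z [[xS yS zS] [xy xz yz]]]]] := exists_top_triangle S2 S0 r_inj abcS planeS.
have near u : u \in S -> inner (w (r u)) (w (r u)) < D ^+ 2.
  by move=> /rS /w_near; rewrite inorm_lt ?(ltW D0).
(* Half of [w i + w j - w k] approximates an element of [G], for [{j, k} = {u, v}]
   and [i] the smallest index. *)
have obtuse u v : u \in S -> v \in S ->
    u + v \in S /\ (r (u + v)%R < minn (r u) (r v))%N ->
    inner (w (r u)) (w (r v)) *+ 2 < - D ^+ 2.
  move=> uIS vS [uvS]; have tK := rK _ uvS; have := near _ uvS; have := s_range (rS _ uvS).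
  move: (r (u + v)) tK => t tK /andP[ht _] near_t; rewrite leq_min => /andP[tu tv].
  have sum_far p q : p \in S -> q \in S -> p + q = u + v -> (t < r q)%N ->
      (D + D) ^+ 2 <= inner (w t + w (r p) - w (r q)) (w t + w (r p) - w (r q)).
    move=> pS qS pq tq.
    have /andP[hp p2] := s_range (rS _ pS); have /andP[hq q2] := s_range (rS _ qS).
    rewrite -inorm_ge ?addr_ge0 ?(ltW D0) //.
    (* [t] and [r p] exceed [h], so the index [t + r p - r q] is positive; [t < r q] keeps it below
       [r p <= 2 h]. Its class is [(p + q) + p - q = 0]. *)
    have qtp : (r q < t + r p)%N.
      by apply: leq_ltn_trans q2 _; rewrite -addnS leq_add // ltnW.
    have kE : (t + r p - r q)%N%:Z = t%:Z + (r p)%:Z - (r q)%:Z.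
      by rewrite -subzn ?PoszD // ltnW.
    apply: (@double_closure_far _ (t + r p - r q)) => //; last first.
      by rewrite subn_gt0 qtp leq_subLR (leq_add (ltnW tq) p2).
    rewrite kE -quot_pi_eq0 (quot_piB _ (W t + W (r p)) (W (r q))) quot_piD tK.
    by rewrite !rK // -pq addrAC addrK S2.
  exact: obtuse_of_far (near u uIS) (near v vS) near_t
    (sum_far u v uIS vS (erefl _) tv) (sum_far v u vS uIS (addrC _ _) tu).
exact: no_obtuse_triangle (near x xS) (near y yS) (near z zS)
  (obtuse x y xS yS xy) (obtuse x z xS zS xz) (obtuse y z yS zS yz).
Qed.

End Configuration.

(** * Nearest-neighbour distances *)

Section OrbitDistances.
Local Open Scope quotient_scope.
Variables (R : realType) (V : innerVectType R) (U : ultrametricZmodType R).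
Variable L : zmodClosed (maxprod V U).
Local Notation X := (Quotient.quot L).
Implicit Types (x y alpha : X) (a b : maxprod V U).

Lemma maxnorm_ge0 a : 0 <= maxnorm a.
Proof. by rewrite le_max inorm_ge0. Qed.

Lemma mdistN (u : U) : mdist (- u) 0 = mdist u 0.
Proof. by rewrite -(mdistDr u) addNr add0r metric_sym. Qed.

Lemma mdistB_lt (u v : U) (D : R) : mdist u 0 < D -> mdist v 0 < D -> mdist (u - v) 0 < D.
Proof.
move=> uD vD; rewrite -(mdistDr v) subrK add0r.
by apply: le_lt_trans (mdist_ultra u 0 v) _; rewrite gt_max uD metric_sym.
Qed.

Lemma maxnormN a : maxnorm (- a) = maxnorm a.
Proof. by rewrite /maxnorm inormN mdistN. Qed.

(** The strict bound provides a short lift even when the infimum is not attained. *)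
Lemma quot_norm_lt a (D : R) :
  quot_norm (\pi_X a) < D -> exists2 b, b - a \in L & maxnorm b < D.
Proof.
rewrite quot_norm_pi => /inf_lt[|_ [l lL <-] lD].
  by exists (maxnorm (a - 0)), 0 => //; exact: rpred0.
by exists (a - l) => //; rewrite addrAC subrr add0r rpredN.
Qed.

Lemma quot_norm_le a b : b - a \in L -> quot_norm (\pi_X a) <= maxnorm b.
Proof.
move=> ba; rewrite quot_norm_pi; apply: ge_inf.
  by exists 0 => _ [l _ <-]; exact: maxnorm_ge0.
by exists (a - b); [rewrite /= -opprB rpredN|rewrite subKr].
Qed.

Lemma quot_normN x : quot_norm (- x) = quot_norm x.
Proof.
suff le y : quot_norm (- y) <= quot_norm y.
  by apply/le_anti; rewrite le -{1}(opprK x) le.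
rewrite leNgt; apply/negP; rewrite -[y]reprK => /quot_norm_lt[b bL].
rewrite -quot_piN ltNge => /negP; apply.
by rewrite -maxnormN; apply: quot_norm_le; rewrite -opprD rpredN.
Qed.

Lemma seq_min_le (s : seq R) r : r \in s -> seq_min s <= r.
Proof. by move=> rs; rewrite /seq_min; exact: ge_bigmin_seq. Qed.

Lemma seq_min_mem (s : seq R) r : r \in s -> seq_min s \in s.
Proof.
case: s => // r0 s _; rewrite /seq_min /=.
rewrite big_seq; elim/big_ind: _ => [|x y xs ys|//]; first exact: mem_head.
by rewrite minEle; case: ifP.
Qed.

Variables (N : nat) (alpha : X).

Lemma multiplesP x :
  reflect (exists2 i, (i < N)%N & x = alpha *+ i) (x \in multiples N alpha).
Proof.
apply: (iffP idP) => [/imfsetP[i /=]|[i iN ->]].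
  by rewrite mem_iota => /andP[_ iN] ->; exists i.
by apply/imfsetP; exists i; rewrite //= mem_iota.
Qed.

Lemma nn_dist_le x y :
  y \in multiples N alpha -> y != x -> nn_dist N alpha x <= quot_norm (x - y).
Proof.
move=> yO yx; apply: seq_min_le; apply/mapP; exists y => //.
by rewrite mem_filter yx.
Qed.

Lemma nn_dist_attained x y : y \in multiples N alpha -> y != x ->
  exists z, [/\ z \in multiples N alpha, z != x & nn_dist N alpha x = quot_norm (x - z)].
Proof.
move=> yO yx; have /seq_min_mem /mapP[z] : quot_dist x y \in
    [seq quot_dist x y | y <- multiples N alpha & y != x].
  by apply/mapP; exists y => //; rewrite mem_filter yx.
by rewrite mem_filter => /andP[zx zO] zE; exists z.
Qed.

Lemma nn_count_le_seq (t : seq R) :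
  {in multiples N alpha, forall x, nn_dist N alpha x \in t} ->
  (1 < #|` multiples N alpha|)%N -> (nn_count N alpha <= size t)%N.
Proof.
move=> ht O1; rewrite /nn_count O1; apply: uniq_leq_size; first exact: fset_uniq.
by move=> _ /imfsetP[x /= xO ->]; exact: ht.
Qed.

Lemma multiples_neq x : (1 < #|` multiples N alpha|)%N ->
  exists2 y, y \in multiples N alpha & y != x.
Proof.
move=> O1; apply: contrapT => noy; move: O1; rewrite ltnNge => /negP; apply.
apply: (@uniq_leq_size _ (multiples N alpha) [:: x]); first exact: fset_uniq.
by move=> y yO; rewrite inE; apply: contraT => yx; case: noy; exists y.
Qed.

(** The orbit is then a finite cyclic group, on which translations are transitive isometries, so all
    nearest-neighbour distances agree. *)
Lemma nn_count_periodic p : (0 < p < N)%N -> alpha *+ p = 0 -> (nn_count N alpha <= 1)%N.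
Proof.
move=> /andP[p0 pN] ap; have [O1|O1] := ltnP 1 #|` multiples N alpha|; last first.
  by rewrite /nn_count ltnNge O1.
have mulO n : alpha *+ n \in multiples N alpha.
  apply/multiplesP; exists (n %% p)%N; first exact: ltn_trans (ltn_pmod n p0) pN.
  by rewrite [in LHS](divn_eq n p) mulrnDr mulnC mulrnA ap mul0rn add0r.
have OB x y z : x \in multiples N alpha -> y \in multiples N alpha ->
    z \in multiples N alpha -> x + y - z \in multiples N alpha.
  move=> /multiplesP[i _ ->] /multiplesP[j _ ->] /multiplesP[k _ ->].
  have -> : alpha *+ i + alpha *+ j - alpha *+ k = alpha *+ (i + j + k * p.-1).
    apply/eqP; rewrite subr_eq -!mulrnDr -addnA -mulnSr prednK // mulnC (mulrnDr _ (i + j)).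
    by rewrite mulrnA ap mul0rn addr0.
  exact: mulO.
have const x x' : x \in multiples N alpha -> x' \in multiples N alpha ->
    nn_dist N alpha x <= nn_dist N alpha x'.
  move=> xO x'O; have [y yO yx'] := multiples_neq x' O1.
  have [z [zO zx' ->]] := nn_dist_attained yO yx'.
  have -> : x' - z = x - (x + z - x') by rewrite opprB addrCA opprD [x + _]addrA subrr add0r.
  apply: nn_dist_le; first exact: OB.
  by rewrite subr_eq; apply: contra_neq zx' => /addrI.
apply: (@nn_count_le_seq [:: nn_dist N alpha 0]) => // x xO; rewrite inE.
by apply/eqP/le_anti; rewrite !const // -(mulr0n alpha).
Qed.

(* The nearest neighbour of [i * alpha] is at distance
   [min_(0 < k <= max(i, N - 1 - i)) |k * alpha|], where the maximum is at least
   [N./2]. *)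
Lemma nn_count_config : (2 <= N)%N -> (1 < nn_count N alpha)%N ->
  exists (D : R) (s : seq nat), [/\ uniq s,
    forall q, q \in s -> (N./2 < q <= N./2 + N./2)%N /\ quot_norm (alpha *+ q) < D,
    forall k, (0 < k <= N./2)%N -> D <= quot_norm (alpha *+ k) &
    (nn_count N alpha <= size s + 1)%N].
Proof.
move=> N2 c1; have O1 : (1 < #|` multiples N alpha|)%N.
  by move: c1; rewrite /nn_count; case: ifP.
have np k : (0 < k < N)%N -> alpha *+ k != 0.
  by move=> kN; apply: contraTneq c1 => /(nn_count_periodic kN); rewrite -leqNgt.
have alpha_inj i j : (i < N)%N -> (j < N)%N -> i != j -> alpha *+ i != alpha *+ j.
  wlog ij : i j / (i < j)%N => [hw iN jN|iN jN _].
    rewrite neq_ltn => /orP[] lt; first by apply: hw; rewrite // neq_ltn lt.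
    by rewrite eq_sym; apply: hw; rewrite // neq_ltn lt.
  rewrite eq_sym -subr_eq0 -mulrnBr ?(ltnW ij) // np // subn_gt0 ij.
  by rewrite (leq_ltn_trans (leq_subr _ _)).
pose h := N./2; have h0 : (0 < h)%N by rewrite /h; lia.
pose nrm k := quot_norm (alpha *+ k).
have nrmB i j : quot_norm (alpha *+ i - alpha *+ j) =
    nrm (if (i < j)%N then j - i else i - j)%N.
  case: ltnP => ij; rewrite /nrm ?mulrnBr ?(ltnW ij) //.
  by rewrite -quot_normN opprB.
pose D := seq_min [seq nrm k | k <- iota 1 h].
have D_le k : (0 < k <= h)%N -> D <= nrm k.
  by move=> kh; apply: seq_min_le; rewrite map_f // mem_iota add1n ltnS.
have [k0 k0h D_eq] : exists2 k, (0 < k <= h)%N & D = nrm k.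
  have /seq_min_mem /mapP[k] : nrm 1 \in [seq nrm k | k <- iota 1 h].
    by rewrite map_f // mem_iota add1n ltnS h0.
  by rewrite mem_iota add1n ltnS => kh kE; exists k.
pose s := [seq q <- iota h.+1 (N - h.+1) | nrm q < D].
exists D, s; split.
- by rewrite filter_uniq ?iota_uniq.
- move=> q; rewrite mem_filter mem_iota => /andP[qD qh]; split=> //.
  rewrite -/h; move: qh; rewrite /h; lia.
- exact: D_le.
rewrite addn1 -(size_map nrm s); apply: (@nn_count_le_seq (D :: map nrm s)) => //.
move=> _ /multiplesP[i iN ->].
have le_D : nn_dist N alpha (alpha *+ i) <= D.
  (* As [k0 <= N./2], one of [i + k0] and [i - k0] is an index of the orbit. *)
  have [j [jN ij jE]] : exists j, [/\ (j < N)%N, j != i & (if i < j then j - i else i - j) = k0]%N.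
    have [lt|le] := ltnP (i + k0) N.
      by exists (i + k0)%N; split; [|lia|case: ltnP; lia].
    rewrite /h in k0h; exists (i - k0)%N; split; [lia..|].
    case: ltnP; lia.
  rewrite D_eq -jE -nrmB; apply: nn_dist_le; last exact: alpha_inj.
  by apply/multiplesP; exists j.
have [y yO yi] := multiples_neq (alpha *+ i) O1.
have [_ [/multiplesP[j jN ->] ji distE]] := nn_dist_attained yO yi.
have ij : i != j by apply: contra_neq ji => ->.
move: distE; rewrite nrmB; set q := (if _ then _ else _) => distE.
have qN : (0 < q < N)%N by rewrite /q; case: ifP; lia.
rewrite distE in le_D *; rewrite inE; case: eqP => //= /eqP qD.
have {qD}le_D : nrm q < D by rewrite lt_neqAle qD.
apply: map_f; rewrite mem_filter le_D mem_iota /=.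
have [qh|hq] := leqP q h; last by lia.
by move: le_D; rewrite ltNge D_le // qh; case/andP: qN => ->.
Qed.

End OrbitDistances.

(** * Projection to the effective space *)

Section PerpProjection.
Variables (R : realType) (V : innerVectType R) (U : ultrametricZmodType R).
Variable L : zmodClosed (maxprod V U).
Local Notation W := (lineality L).
Local Notation Wp := (lineality_perp L).
Local Notation pr := (perp_proj L).

Lemma orthogonal_part (E : {vspace V}) v :
  exists2 f, v - f \in E & {in E, forall u, inner f u = 0}.
Proof.
have [o [oin oE]] := orthonormal_family E.
pose g := \sum_i inner v (o i) *: o i.
exists (v - g); first by rewrite subKr memv_suml // => i _; rewrite memvZ.
move=> u uE; rewrite innerBl {1}(oE u uE) inner_sumr /g inner_suml -sumrB big1 // => i _.
by rewrite innerZl innerZr (innerC (o i)) mulrC subrr.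
Qed.

Lemma perp_capv : (Wp :&: W)%VS = 0%VS.
Proof.
apply/eqP; rewrite -subv0; apply/subvP => u; rewrite memv_cap memv0.
move=> /andP[/mem_orthovP up uW]; apply: contraTT isT => u0.
by have := inner_gt0 u0; rewrite (up u uW) ltxx.
Qed.

Lemma perp_proj_decomp v : pr v + daddv_pi W Wp v = v.
Proof.
apply: daddv_pi_add; first exact: perp_capv.
have [f vf fp] := orthogonal_part W v.
rewrite -(subrK f v) addrC memv_add //.
by apply/mem_orthovP => u /fp.
Qed.

(** Moving along the lineality space stays within a coset of [L], so lifts may be replaced by their
    projections, whose norm is no larger. *)
Lemma perp_proj_sub v : ((pr v - v, 0) : maxprod V U) \in L.
Proof.
have wW : pr v - v \in W.
  rewrite -{2}(perp_proj_decomp v) opprD addrA subrr add0r memvN.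
  exact: memv_pi.
by have /mem_lineality /(_ 1) := wW; rewrite scale1r.
Qed.

Lemma inorm_perp_proj v : inorm (pr v) <= inorm v.
Proof.
rewrite -(@ler_pXn2r _ 2) ?nnegrE ?inorm_ge0 // !inorm_sqr.
rewrite -[in leRHS](perp_proj_decomp v) innerDD.
have -> : inner (pr v) (daddv_pi W Wp v) = 0.
  by have /mem_orthovP := memv_pi Wp W v; apply; exact: memv_pi.
by rewrite mul0rn addr0 lerDl inner_ge0.
Qed.

Lemma perp_proj_effective a : a \in L -> pr a.1 \in effective_space L.
Proof. by move=> aL; apply: (vspanP _).1; rewrite inE; exists a. Qed.

End PerpProjection.

(** * The group of lifts of the multiples of a point *)

Section OrbitLattice.
Variables (R : realType) (V : innerVectType R) (U : ultrametricZmodType R).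
Variable L : zmodClosed (maxprod V U).
Variables (a : maxprod V U) (f : V) (D : R).

(** This is a group because the open ball of radius [D] in [U] is one, by the ultrametric
    inequality. *)
Definition orbit_lattice : {pred V * int} := fun x =>
  `[< exists u : U, [/\ ((x.1, u) : maxprod V U) - a *~ x.2 \in L,
    x.1 - f *~ x.2 \in effective_space L & mdist u 0 < D] >].

Lemma orbit_lattice_zmod : 0 < D -> zmod_closed orbit_lattice.
Proof.
move=> D0; split=> [|[v k] [w l] /asboolP[u [uL uE uD]] /asboolP[z [zL zE zD]]].
  apply/asboolP; exists 0; split=> /=; last by rewrite mdistxx.
    by rewrite mulr0z subr0 rpred0.
  by rewrite mulr0z subr0 mem0v.
apply/asboolP; exists (u - z); split=> /=; last exact: mdistB_lt.
- by have := rpredB uL zL; rewrite subr_mulrzB.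
- by have := rpredB uE zE; rewrite subr_mulrzB.
Qed.

End OrbitLattice.

Theorem corollary1 (R : realType)
  (V : innerVectType R) (dimV_gt0 : (1 <= \dim {:V})%N)
  (U : ultrametricZmodType R)
  (L : zmodClosed (maxprod V U))
  (closedL : closed [set a : maxprod V U | a \in L])
  (alpha : Quotient.quot L) (N : nat) (N_ge2 : (2 <= N)%N) :
  [/\ (1 <= effective_dim L)%N ->
        (nn_count N alpha <= strong_kissing R (effective_dim L) + 1)%N,
      effective_dim L = 0%N -> (nn_count N alpha <= 2)%N,
      effective_dim L = 1%N -> (nn_count N alpha <= 3)%N,
      effective_dim L = 2%N -> (nn_count N alpha <= 6)%N &
      effective_dim L = 3%N -> (nn_count N alpha <= 13)%N].
Proof.
suff [s [count_le kiss parity]] : exists s : seq nat,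
    [/\ (nn_count N alpha <= size s + 1)%N,
     (1 < size s)%N -> (size s <= strong_kissing R (effective_dim L))%N &
     effective_dim L = 3%N -> (size s <= 12)%N].
  split=> [m1|m0|m1|m2|m3]; apply: leq_trans count_le _.
  - rewrite leq_add2r; have [/kiss //|s1] := ltnP 1 (size s).
    by apply: leq_trans s1 _; case: (effective_dim L) m1 => // m _; exact: strong_kissing_gt0.
  - rewrite m0 strong_kissing0 in kiss; have [/kiss|] := ltnP 1 (size s); lia.
  - rewrite m1 in kiss; have := strong_kissing1_le R.
    have [/kiss|] := ltnP 1 (size s); lia.
  - rewrite m2 in kiss; have := strong_kissing2_le R.
    have [/kiss|] := ltnP 1 (size s); lia.
  - by have := parity m3; lia.
(* With at most one distance the empty list suffices; otherwise [s] lists the near returns, and a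
   member of it, if any, witnesses [0 < D]. *)
have [c1|c1] := leqP (nn_count N alpha) 1; first by exists [::].
have [D [s [us s_near D_le count_le]]] := nn_count_config N_ge2 c1.
exists s; have [s0|[q0 q0s]] : s = [::] \/ exists q, q \in s.
- by case: (s) => [|q t]; [left|right; exists q; rewrite mem_head].
- by rewrite s0 in count_le *.
pose b := repr alpha; pose pr := perp_proj L.
pose a : maxprod V U := (pr b.1, b.2).
have prL (c : maxprod V U) : ((pr c.1, c.2) : maxprod V U) - c \in L.
  by have := perp_proj_sub L c.1; congr (_ \in L); congr (_, _); rewrite /= subrr.
have [f eE fE] := orthogonal_part (effective_space L) (pr b.1).
have rep q : q \in s -> exists2 c : maxprod V U, c - b *+ q \in L & maxnorm c < D.
  by case/s_near => _ qD; apply: quot_norm_lt; rewrite quot_piMn reprK.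
have D0 : 0 < D by have [c _] := rep _ q0s; apply: le_lt_trans (maxnorm_ge0 _).
have GZ := orbit_lattice_zmod L a f D0.
pose G : zmodClosed (V * int)%type :=
  HB.pack (orbit_lattice L a f D) (GRing.isZmodClosed.Build _ _ GZ).
have ex_w q : exists v, q \in s -> (v, q%:Z) \in G /\ inorm v < D.
  have [qs|] := boolP (q \in s); last by exists 0.
  have [c cL cD] := rep q qs; exists (pr c.1) => _.
  have /andP[c1D c2D] : (inorm c.1 < D) && (mdist c.2 0 < D) by rewrite -gt_max.
  split; last exact: le_lt_trans (inorm_perp_proj _ _) c1D.
  apply/asboolP; exists c.2; split=> //=; rewrite -pmulrn.
    have := rpredB (rpredD (prL c) cL) (rpredMn q (prL b)).
    by rewrite subrKA mulrnBl opprB subrKA.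
  (* The first summand is the projection of an element of [L]; the second is a multiple of
     [pr b.1 - f], effective by the choice of [f]. *)
  have -> : pr c.1 - f *+ q = pr (c - b *+ q).1 + (pr b.1 - f) *+ q.
    have fstM n : (b *+ n).1 = b.1 *+ n by elim: n => // n IH; rewrite !mulrS -IH.
    have -> : (c - b *+ q).1 = c.1 - b.1 *+ q by rewrite -fstM.
    have prM : pr (b.1 *+ q) = pr b.1 *+ q by rewrite linearMn.
    by rewrite mulrnBl linearB /= prM subrKA.
  by apply: rpredD; [exact: perp_proj_effective|exact: rpredMn].
have [w wP] := choice ex_w.
have wG q : q \in s -> (w q, q%:Z) \in G by move=> /wP[].
have w_near q : q \in s -> inorm (w q) < D by move=> /wP[].
have s_range q : q \in s -> (N./2 < q <= N./2 + N./2)%N by move=> /s_near[].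
have GE v (k : int) : (v, k) \in G -> v - f *~ k \in effective_space L.
  by move=> /asboolP[u []].
have G_far v (k : nat) : (v, k%:Z) \in G -> (0 < k <= N./2)%N -> D <= inorm v.
  move=> /asboolP[u /= [uL _ uD]] /D_le kD.
  (* [(v, u)] differs from a lift of [alpha *+ k] by an element of [L], so its norm is at least [D];
     as [u] is shorter than [D], the bound falls on [v]. *)
  have : D <= maxnorm ((v, u) : maxprod V U).
    apply: le_trans kD _; rewrite -[alpha]reprK -quot_piMn; apply: quot_norm_le.
    have := rpredD uL (rpredMn k (prL b)).
    by rewrite -pmulrn mulrnBl subrKA.
  by rewrite le_max /= leNgt [D <= mdist _ _]leNgt uD orbF -leNgt.
have [o [_ oE]] := orthonormal_family (effective_space L).
split=> //.
  exact: (size_le_strong_kissing GE G_far us s_range wG w_near fE).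
exact: (size_le_parity GE G_far us s_range wG w_near oE).
Qed.
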